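(* Let $(E,<)$ be a finite linearly ordered set. Let $\vartriangleleft$ be any total order on the set $\mathcal{L}^{>1}(E)$ of subsets of $E$ with at least two elements such that for all $F_1,F_2\in\mathcal{L}^{>1}(E)$: if $\max F_1<\max F_2$ then $F_1\vartriangleleft F_2$; and if $\max F_1=\max F_2$ and $F_1\supsetneq F_2$ then $F_1\vartriangleleft F_2$. Then the degree $2$ part $\mathcal{I}^{(2)}_{\mathrm{ss}}(E)$ of the ideal $\mathcal{I}_{\mathrm{ss}}(E)$ is a quadratic Gröbner basis of $\mathcal{I}_{\mathrm{ss}}(E)$ for the degree lexicographic order on monomials induced by $\vartriangleleft$. In addition, a quadratic monomial $g_{S_1}g_{S_2}$ is normal with respect to this Gröbner basis if and only if, possibly after exchanging $S_1$ and $S_2$, the following hold with $S=S_1\cup S_2$: (i) $\mathrm{Card}(S_1)\ge 2$ and $\mathrm{Card}(S_2)\ge2$; (ii) $S_1$ is an initial segment of $S$, and it is the minimal initial segment $I$ of $S$ satisfying $I\cup S_2=S$; (iii) $\mathrm{Card}(S\setminus S_2)\ge 2$ unless $S_2=S\setminus\{\max S\}$.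
   Context: The Chow ring of the boolean matroid on a finite set $E$ is $\underline{\mathrm{CH}}(\mathrm{B}_E)=\mathbb{Q}[x_F,\ \emptyset\ne F\subset E]/(\mathcal{I}+\mathcal{J})$, where $\mathcal{I}$ is generated by the elements $\sum_{F\ni i}x_F$ for $i\in E$, and $\mathcal{J}$ is generated by the products $x_{F_1}x_{F_2}$ for all pairs of nonempty subsets $F_1,F_2\subset E$ that are incomparable for inclusion. It is graded with generators in degree $1$. For $E$ linearly ordered and $F$ a nonempty subset of $E$, let $g_F=\sum_{S\subset E_{>\max F}}x_{F\cup S}\in\underline{\mathrm{CH}}(\mathrm{B}_E)$, where $E_{>e}=\{i\in E\mid i>e\}$. The elements $g_F$ with $F\in\mathcal{L}^{>1}(E)$ generate $\underline{\mathrm{CH}}(\mathrm{B}_E)$ as a ring. Using the same symbols $g_F$ for formal variables, $\mathcal{I}_{\mathrm{ss}}(E)$ is the kernel of the natural morphism $\mathbb{Q}[g_F,\ F\in\mathcal{L}^{>1}(E)]\to\underline{\mathrm{CH}}(\mathrm{B}_E)$ from the polynomial ring. Given a total order $\vartriangleleft$ on a finite set $V$, the associated degree lexicographic order on the monomials of $\mathbb{K}[V]$ is defined by: $x_{v_1}\cdots x_{v_n}\vartriangleleft_{deglex}x_{v'_1}\cdots x_{v'_m}$ (with $v_1\trianglelefteq\dots\trianglelefteq v_n$ and $v'_1\trianglelefteq\dots\trianglelefteq v'_m$) if $n<m$; or $n=m$ and $v_1\vartriangleleft v'_1$; or $n=m$, $v_1=v_1'$ and $x_{v_2}\cdots x_{v_n}\vartriangleleft_{deglex}x_{v'_2}\cdots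 x_{v'_m}$. The leading term of a nonzero polynomial is its greatest monomial with nonzero coefficient. A subset $\mathcal{G}$ of an ideal is a Gröbner basis of that ideal if the leading term of every nonzero element of the ideal is divisible by the leading term of some nonzero element of $\mathcal{G}$; it is quadratic if it contains only homogeneous elements of degree $2$. A monomial is normal with respect to $\mathcal{G}$ if it is not divisible by the leading term of any nonzero element of $\mathcal{G}$. For nonempty subsets $I\subset J$ of $E$, $I$ is an initial segment of $J$ if $I=J\cap\{i\in E\mid i\le\max I\}$. *)

(* Defs.v *)
From HB Require Import structures.
From mathcomp Require Import all_boot all_order all_algebra.
From mathcomp Require Import boolp.
From mathcomp.multinomials Require Import mpoly.

Set Implicit Arguments.
Unset Strict Implicit.
Unset Printing Implicit Defensive.

Import Order.TTheory GRing.Theory.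

Local Open Scope ring_scope.
Local Open Scope quotient_scope.

(* {mpoly R[n]} has its variables indexed by 'I_n, so the polynomial ring on a
   finite set V of variables is {mpoly R[#|V|]}, via enum_rank. *)
Definition mvar (V : finType) (v : V) : 'X_{1..#|V|} := U_(enum_rank v)%MM.
Definition pvar (R : nzRingType) (V : finType) (v : V) : {mpoly R[#|V|]} :=
  'X_(enum_rank v).
Arguments pvar R {V} v.

Section GroebnerBases.
Variables (K : fieldType) (V : finType).
(* The reflexive version of the total order on the variables. *)
Variable vle : rel V.

Definition vlt : rel V := fun v w => (v != w) && vle v w.

Definition mword (m : 'X_{1..#|V|}) : seq V :=
  sort vle (flatten [seq nseq (m (enum_rank v)) v | v <- enum V]).

Fixpoint deglex_word (s t : seq V) : bool :=
  (size s < size t)%N || (size s == size t) &&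
    match s, t with
    | v :: s', w :: t' => vlt v w || (v == w) && deglex_word s' t'
    | _, _ => false
    end.

Definition deglex (m1 m2 : 'X_{1..#|V|}) : bool :=
  deglex_word (mword m1) (mword m2).

(* The greatest monomial of p; the starting value 0%MM is the monomial 1, which
   is the least one for deglex. *)
Definition leading (p : {mpoly K[#|V|]}) : 'X_{1..#|V|} :=
  foldr (fun m m' => if deglex m' m then m else m') 0%MM (msupp p).

Definition groebner_basis (I G : {mpoly K[#|V|]} -> Prop) : Prop :=
  (forall q, G q -> I q) /\
  (forall p, I p -> p != 0 ->
     exists q, [/\ G q, q != 0 & (leading q <= leading p)%MM]).

Definition quadratic (G : {mpoly K[#|V|]} -> Prop) : Prop :=
  forall q, G q -> q \is 2.-homog.

Definition normal_monomial (G : {mpoly K[#|V|]} -> Prop) (m : 'X_{1..#|V|}) :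
    Prop :=
  forall q, G q -> q != 0 -> ~~ (leading q <= m)%MM.

End GroebnerBases.

Definition ideal_gen (R : comNzRingType) (G : R -> Prop) (p : R) : Prop :=
  exists2 s : seq (R * R), {in s, forall c, G c.2} & p = \sum_(c <- s) c.1 * c.2.

Lemma ideal_gen0 (R : comNzRingType) (G : R -> Prop) : ideal_gen G 0.
Proof. by exists [::]; rewrite ?big_nil. Qed.

Lemma ideal_genMD (R : comNzRingType) (G : R -> Prop) a u v :
  ideal_gen G u -> ideal_gen G v -> ideal_gen G (a * u + v).
Proof.
move=> [s Gs ->] [t Gt ->].
exists ([seq (a * c.1, c.2) | c <- s] ++ t); last first.
  rewrite big_cat big_map mulr_sumr /=; congr (_ + _).
  by apply: eq_bigr => c _; rewrite mulrA.
move=> c; rewrite mem_cat => /orP[/mapP[d ds ->]|ct]; last exact: Gt.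
exact: (Gs d).
Qed.

Definition neset (E : finType) : finType := {F : {set E} | F != set0}.
Definition bigset (E : finType) : finType := {F : {set E} | (1 < #|F|)%N}.

Lemma bigset_neq0 (E : finType) (F : bigset E) : val F != set0.
Proof. by rewrite -card_gt0 (ltn_trans _ (valP F)). Qed.

Definition bigset_ne (E : finType) (F : bigset E) : neset E :=
  Sub (val F) (bigset_neq0 F).

Lemma neset_setU_neq0 (E : finType) (F : neset E) (S : {set E}) :
  val F :|: S != set0.
Proof. by rewrite setU_eq0 negb_and (valP F). Qed.

Definition neset_setU (E : finType) (F : neset E) (S : {set E}) : neset E :=
  Sub (val F :|: S) (neset_setU_neq0 F S).

Section ChowRing.
Variable E : finType.

Local Notation QX := {mpoly rat[#|neset E|]}.

Definition chow_linear_rel (p : QX) : Prop :=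
  exists i : E, p = \sum_(F : neset E | i \in val F) pvar rat F.

Definition chow_quadratic_rel (p : QX) : Prop :=
  exists F1 F2 : neset E,
    [/\ ~~ (val F1 \subset val F2), ~~ (val F2 \subset val F1)
      & p = pvar rat F1 * pvar rat F2].

Definition chow_ideal (p : QX) : bool :=
  `[< exists a b, [/\ ideal_gen chow_linear_rel a,
                      ideal_gen chow_quadratic_rel b & p = a + b] >].

Lemma ideal_gen_coef0 (G : QX -> Prop) p :
  (forall q, G q -> q@_0%MM = 0) -> ideal_gen G p -> p@_0%MM = 0.
Proof.
move=> G0 [s Gs ->]; rewrite raddf_sum /= big_seq big1 // => c cs.
by rewrite rmorphM /= (G0 c.2) ?mulr0 //; apply: (Gs c).
Qed.

Lemma pvar_coef0 (F : neset E) : (pvar rat F)@_0%MM = 0.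
Proof. by rewrite /pvar mcoeffX -mdeg_eq0 mdeg1. Qed.

Lemma chow_ideal_closed : idealr_closed chow_ideal.
Proof.
split.
- apply/asboolP; exists 0, 0; rewrite addr0.
  by split=> //; apply: ideal_gen0.
- apply/negP => /asboolP[a [b [Ia Jb]]] /(congr1 (mcoeff 0%MM)).
  rewrite mcoeffD (ideal_gen_coef0 _ Ia) ?(ideal_gen_coef0 _ Jb) ?addr0.
  + by rewrite mcoeff1 eqxx => /eqP; rewrite oner_eq0.
  + by move=> _ [F1 [F2 [_ _ ->]]];
      rewrite rmorphM /= pvar_coef0 mul0r.
  + by move=> _ [i ->]; rewrite raddf_sum /= big1 // => F _; exact: pvar_coef0.
- move=> r u v /asboolP[a [b [Ia Jb ->]]] /asboolP[c [d [Ic Jd ->]]].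
  apply/asboolP; exists (r * a + c), (r * b + d).
  by split; [exact: ideal_genMD.. | rewrite mulrDr addrACA].
Qed.

HB.instance Definition _ := isIdealr.Build QX chow_ideal chow_ideal_closed.

Definition chow_idealr : idealr QX := chow_ideal.
Definition chow : comNzRingType := {ideal_quot chow_idealr}.

Definition chow_pi (p : QX) : chow := \pi_{ideal_quot chow_idealr} p.

Definition chow_x (F : neset E) : chow := chow_pi (pvar rat F).

End ChowRing.

Section SimplicialPresentation.
Variables (d : Order.disp_t) (E : finOrderType d).

Definition neset_elt (F : neset E) : E := xchoose (set0Pn _ (valP F)).

Definition setmax (F : neset E) : E :=
  [arg max_(i > neset_elt F in val F) i]%O.

Definition chow_g (F : neset E) : chow E :=
  \sum_(S : {set E} | S \subset [set i | (setmax F < i)%O])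
     chow_x (neset_setU F S).

Definition ss_morphism : {mpoly rat[#|bigset E|]} -> chow E :=
  mmap (fun c : rat => chow_pi c%:MP)
       (fun i : 'I_#|bigset E| => chow_g (bigset_ne (enum_val i))).

Definition ss_ideal (p : {mpoly rat[#|bigset E|]}) : Prop := ss_morphism p = 0.

Definition ss_ideal2 (p : {mpoly rat[#|bigset E|]}) : Prop :=
  ss_ideal p /\ p \is 2.-homog.

Definition initial_segment (I J : neset E) : Prop :=
  val I = val J :&: [set i | (i <= setmax I)%O].

Definition normal_pair (S1 S2 : neset E) : Prop :=
  let S := neset_setU S1 (val S2) in
  [/\ (2 <= #|val S1|)%N /\ (2 <= #|val S2|)%N,
      [/\ initial_segment S1 S, val S1 :|: val S2 = val S
        & forall I : neset E, initial_segment I S ->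
            val I :|: val S2 = val S -> val S1 \subset val I]
    & val S2 <> val S :\ setmax S -> (2 <= #|val S :\: val S2|)%N].

End SimplicialPresentation.

(* Main.v *)
From HB Require Import structures.
Require Import Defs.
From mathcomp Require Import all_boot all_order all_algebra.
From mathcomp Require Import boolp.
From mathcomp.multinomials Require Import mpoly.

(** Write U_p for the set of elements at most p and X_p(A) for the sum of the
    x_F with F meeting U_p in A, so that g_F = X_(max F)(F). The products
    X_p(A) X_p(B) vanish for incomparable A and B, the sum of the X_p(A) with A
    containing a given element of U_p vanishes, and the classes X_p(A) are
    compatible with removing p from U_p. These relations rewrite g_S g_T as a
    combination of smaller monomials whenever (S, T) is not a normal pair in
    either order.

    Conversely, deforming the linear relations to "the sum of the x_F with F
    containing i is a constant t_i", with the t_i distinct and nonzero, turns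
    the Chow ring into the ring of functions on the n! orderings of E, filtered
    by degree: this is localization at the torus-fixed points of the
    permutohedral variety. By the rewriting above, the functions attached to
    the monomials with only normal pairs span this ring. There are at most n! of
    them: if m is the greatest element and F u {m} is the letter containing m, the
    others split into normal families on F and on the complement of F u {m}.
    They therefore form a basis, and no nonzero element of the ideal has a
    leading monomial with only normal pairs. *)

Set Implicit Arguments.
Unset Strict Implicit.
Unset Printing Implicit Defensive.

Import Order.TTheory GRing.Theory Num.Theory.

(** * The degree lexicographic order *)

Section DegLex.

Variables (V : finType) (vle : rel V).
Hypotheses (vle_refl : reflexive vle) (vle_anti : antisymmetric vle).
Hypotheses (vle_trans : transitive vle) (vle_total : total vle).

Lemma vlt_irr v : vlt vle v v = false.
Proof. by rewrite /vlt eqxx. Qed.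

Lemma vlt_trans : transitive (vlt vle).
Proof.
move=> u v w /andP[nvu vu] /andP[nuw uw]; apply/andP; split; last exact: vle_trans uw.
by apply: contra_neq nvu => evw; apply: vle_anti; rewrite vu evw uw.
Qed.

Lemma vlt_le_trans u v w : vlt vle u v -> vle v w -> vlt vle u w.
Proof.
move=> uv vw; have [<-//|nvw] := eqVneq v w.
by apply: vlt_trans uv _; rewrite /vlt nvw.
Qed.

Lemma vltNge v w : vlt vle v w = ~~ vle w v.
Proof.
rewrite /vlt; have [->|nvw /=] := eqVneq; first by rewrite vle_refl.
apply/idP/idP => [vw|nwv]; last by case/orP: (vle_total v w) nwv => // ->.
by apply: contra nvw => wv; apply/eqP/vle_anti; rewrite vw.
Qed.

Lemma deglex_word_total s t :
  [\/ deglex_word vle s t, s = t | deglex_word vle t s].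
Proof.
elim: s t => [|v s IHs] [|w t] /=;
  [by constructor 2|by constructor 1|by constructor 3|].
rewrite !ltnS !eqSS [size t == _]eq_sym.
have [st|ts|est] := ltngtP; [by constructor 1|by constructor 3|].
have [->|nvw] := eqVneq v w; last first.
  rewrite /vlt (negPf nvw) eq_sym nvw !orbF /=.
  by case/orP: (vle_total v w) => ->; [constructor 1|constructor 3].
rewrite vlt_irr /=.
by case: (IHs t) => [->|->|->]; [constructor 1|constructor 2|constructor 3].
Qed.

Definition word_lt (s t : seq V) : Prop :=
  exists2 v, forall w, vlt vle w v -> count_mem w s = count_mem w t
           & (count_mem v t < count_mem v s)%N.

(** At the first place where two sorted words differ, the smaller of the two letters does not occur
    in the rest of the other word, and letters below it have equal counts. *)
Lemma deglex_word_count s t : sorted vle s -> sorted vle t ->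
  deglex_word vle s t ->
  (size s < size t)%N \/ size s = size t /\ word_lt s t.
Proof.
elim: s t => [|v s IHs] [|w t] //=; try by left.
move=> ps pt; rewrite !ltnS eqSS.
case: ltngtP => //= [_|est]; first by left.
have ss := path_sorted ps; have st := path_sorted pt.
have min_s := allP (order_path_min vle_trans ps).
have min_t := allP (order_path_min vle_trans pt).
have count0 x y r : {in r, forall z, vle y z} -> vlt vle x y -> count_mem x r = 0%N.
  move=> yr; rewrite vltNge => nyx; apply/count_memPn.
  by apply: contra nyx => /yr.
case/orP=> [vw|/andP[/eqP<-]]; last first.
  case/(IHs t ss st) => [|[_ [u lt_u cnt_u]]]; first by rewrite est ltnn.
  right; split; first by rewrite est.
  by exists u => [x /lt_u /= ->|] /=; rewrite ?ltn_add2l.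
right; split; first by rewrite est.
exists v => [x xv|] /=; last first.
  case/andP: (vw) => nvw _.
  by rewrite eqxx [w == v]eq_sym (negPf nvw) (count0 v w).
have xw := vlt_trans xv vw.
rewrite (count0 x v) // (count0 x w) //.
case/andP: xw => nxw _; case/andP: xv => nxv _.
by rewrite [v == x]eq_sym [w == x]eq_sym (negPf nxv) (negPf nxw).
Qed.

Lemma count_mword m v : count_mem v (mword vle m) = m (enum_rank v).
Proof.
rewrite /mword count_sort count_flatten sumnE !big_map -enumT big_enum /=.
rewrite (bigD1 v) //= count_nseq /= eqxx mul1n big1 ?addn0 // => w nwv.
by rewrite count_nseq /= (negPf nwv).
Qed.

Lemma size_mword m : size (mword vle m) = mdeg m.
Proof.
rewrite /mword size_sort size_flatten sumnE !big_map -enumT big_enum /= mdegE.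
rewrite (reindex (@enum_rank V)) /=; last exact: onW_bij (enum_rank_bij V).
by apply: eq_bigr => v _; rewrite size_nseq.
Qed.

(* The word with more occurrences of the least letter [v] that distinguishes two
   words is the smaller one. *)
Definition mlex (m1 m2 : 'X_{1..#|V|}) : Prop :=
  (mdeg m1 < mdeg m2)%N \/ mdeg m1 = mdeg m2 /\
  exists2 v, forall w, vlt vle w v -> m1 (enum_rank w) = m2 (enum_rank w)
           & (m2 (enum_rank v) < m1 (enum_rank v))%N.

Lemma mlex_asym m1 m2 : mlex m1 m2 -> mlex m2 m1 -> False.
Proof.
case=> [lt12|[e12 [v eq_v lt_v]]] [lt21|[e21 [w eq_w lt_w]]].
- by have := ltn_trans lt12 lt21; rewrite ltnn.
- by rewrite e21 ltnn in lt12.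
- by rewrite e12 ltnn in lt21.
have [vw|] := boolP (vlt vle v w); first by rewrite (eq_w v vw) ltnn in lt_v.
rewrite vltNge negbK => wv; have [ewv|nwv] := eqVneq w v.
  by rewrite ewv in lt_w; have := ltn_trans lt_w lt_v; rewrite ltnn.
by rewrite (eq_v w) ?ltnn ?/vlt ?nwv in lt_w.
Qed.

Lemma mword_inj : injective (mword vle).
Proof.
move=> m1 m2 e12; apply/mnmP => i.
by rewrite -[i]enum_valK -!count_mword e12.
Qed.

Lemma deglex_total m1 m2 : [\/ deglex vle m1 m2, m1 = m2 | deglex vle m2 m1].
Proof.
case: (deglex_word_total (mword vle m1) (mword vle m2)) => [||]; first by constructor 1.
- by move/mword_inj; constructor 2.
- by constructor 3.
Qed.

Lemma deglexP m1 m2 : deglex vle m1 m2 <-> mlex m1 m2.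
Proof.
have fwd p q : deglex vle p q -> mlex p q.
  case/(deglex_word_count (sort_sorted vle_total _) (sort_sorted vle_total _)).
    by rewrite -/(mword vle p) -/(mword vle q) !size_mword; left.
  rewrite -/(mword vle p) -/(mword vle q) !size_mword => -[epq [v eq_v lt_v]].
  right; split=> //; exists v; last by rewrite -!count_mword.
  by move=> w /eq_v; rewrite !count_mword.
split=> [|l12]; first exact: fwd.
case: (deglex_total m1 m2) => // [e12|/fwd l21]; last by case: (mlex_asym l12 l21).
by case: l12 => [|[_ [v _]]]; rewrite e12 ltnn.
Qed.

Lemma deglex_irr m : deglex vle m m = false.
Proof. by apply/negP => /deglexP lmm; case: (mlex_asym lmm lmm). Qed.

Lemma deglex_trans : transitive (deglex vle).
Proof.
move=> m2 m1 m3 /deglexP l12 /deglexP l23; apply/deglexP.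
case: l12 => [lt12|[e12 [v eq_v lt_v]]]; case: l23 => [lt23|[e23 [w eq_w lt_w]]].
- by left; apply: ltn_trans lt23.
- by left; rewrite -e23.
- by left; rewrite e12.
right; split; first by rewrite e12.
have [vw|] := boolP (vlt vle v w).
  exists v; last by rewrite -(eq_w v vw).
  by move=> u uv; rewrite eq_v // eq_w //; apply: vlt_trans uv vw.
rewrite vltNge negbK => wv; exists w => [u uw|].
  by rewrite eq_v ?eq_w //; apply: vlt_le_trans wv.
have [ewv|nwv] := eqVneq w v; last by rewrite (eq_v w) // /vlt nwv.
by rewrite ewv in lt_w *; apply: ltn_trans lt_v.
Qed.

Lemma deglex_asym m1 m2 : deglex vle m1 m2 -> ~~ deglex vle m2 m1.
Proof.
by move=> l12; apply/negP => /(deglex_trans l12); rewrite deglex_irr.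
Qed.

Lemma deglex_add m m1 m2 :
  deglex vle m1 m2 -> deglex vle (m1 + m)%MM (m2 + m)%MM.
Proof.
move/deglexP => l12; apply/deglexP; rewrite /mlex !mdegD ltn_add2r.
case: l12 => [|[-> [v eq_v lt_v]]]; [by left|right; split=> //].
by exists v => [w /eq_v|]; rewrite !mnmDE ?ltn_add2r // => ->.
Qed.

Lemma mvarE (v w : V) : mvar v (enum_rank w) = (v == w).
Proof. by rewrite /mvar mnm1E (inj_eq enum_rank_inj). Qed.

Lemma mdeg_mvar (v : V) : mdeg (mvar v) = 1%N.
Proof. exact: mdeg1. Qed.

Lemma deglex_mvar v w : vlt vle v w -> deglex vle (mvar v) (mvar w).
Proof.
move=> vw; apply/deglexP; right; split; first by rewrite !mdeg_mvar.
exists v => [u uv|]; last by rewrite !mvarE eqxx eq_sym; case/andP: vw => /negPf->.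
rewrite !mvarE [v == u]eq_sym [w == u]eq_sym.
case/andP: (vlt_trans uv vw) => /negPf-> _.
by case/andP: uv => /negPf->.
Qed.

Lemma deglex_mvar_add m v w : vlt vle v w -> deglex vle (mvar v + m)%MM (mvar w + m)%MM.
Proof. by move/deglex_mvar/deglex_add; apply. Qed.

(** The smaller of [a] and [b] is below both [u] and [v], hence is the least letter that
    distinguishes the two monomials, whatever [b] is. *)
Lemma deglex_mvar2 a b u v : vlt vle a u -> vlt vle a v ->
  deglex vle (mvar a + mvar b)%MM (mvar u + mvar v)%MM.
Proof.
have wlog_ab x y : vle x y -> vlt vle x u -> vlt vle x v ->
    deglex vle (mvar x + mvar y)%MM (mvar u + mvar v)%MM.
  move=> xy xu xv; apply/deglexP; right; split; first by rewrite !mdegD !mdeg_mvar.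
  have neq p q : vlt vle p q -> (q == p) = false.
    by rewrite eq_sym; case/andP => /negPf.
  exists x => [w wx|]; rewrite !mnmDE !mvarE.
    have wu := vlt_trans wx xu; have wv := vlt_trans wx xv.
    by rewrite !(neq w) //; apply: vlt_le_trans wx xy.
  by rewrite (neq x u) // (neq x v) // eqxx.
case/orP: (vle_total a b) => [ab|ba] au av; first exact: wlog_ab.
have [eab|nab] := eqVneq a b; first by subst b; apply: wlog_ab.
have ba' : vlt vle b a by rewrite /vlt eq_sym nab.
by rewrite [(mvar a + _)%MM]addmC; apply: wlog_ab => //; apply: vlt_trans ba' _.
Qed.

Section Leading.

Variable K : fieldType.
Local Open Scope ring_scope.
Implicit Types p q : {mpoly K[#|V|]}.

Lemma deglex_lt0 m : ~~ deglex vle m 0%MM.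
Proof.
apply/negP => /deglexP[|[e [v _]]]; first by rewrite mdeg0.
by rewrite mnm0E; move/eqP: e; rewrite mdeg0 mdeg_eq0 => /eqP->; rewrite mnm0E.
Qed.

Lemma foldr_deglex_mem (s : seq 'X_{1..#|V|}) :
  s != [::] ->
  foldr (fun m m' => if deglex vle m' m then m else m') 0%MM s \in s.
Proof.
elim: s => // m [|m' s] IHs _ /=.
  case: ifP; rewrite ?inE ?eqxx // => /negbT nl; apply/eqP.
  by case: (deglex_total 0%MM m) => // [l0|l0]; [rewrite l0 in nl|case/negP: (deglex_lt0 m)].
by case: ifP => _; rewrite inE ?eqxx // IHs ?orbT.
Qed.

Lemma foldr_deglex_max (s : seq 'X_{1..#|V|}) m : m \in s ->
  ~~ deglex vle (foldr (fun m m' => if deglex vle m' m then m else m') 0%MM s) m.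
Proof.
elim: s => //= m' s IHs; rewrite inE => /predU1P[->|ms].
  by case: ifPn => //; rewrite deglex_irr.
case: ifP => [l|_]; last exact: IHs.
by apply: contra (IHs ms) => l'; apply: deglex_trans l l'.
Qed.

Lemma leading_supp p : p != 0 -> leading vle p \in msupp p.
Proof. by move=> nz_p; apply: foldr_deglex_mem; rewrite msupp_eq0. Qed.

Lemma leading_max p m : m \in msupp p -> m != leading vle p ->
  deglex vle m (leading vle p).
Proof.
move=> mp nm; case: (deglex_total m (leading vle p)) => [//|e|l].
  by rewrite e eqxx in nm.
by case/negP: (foldr_deglex_max mp).
Qed.

Lemma leadingP p m : m \in msupp p ->
  (forall m', m' \in msupp p -> m' != m -> deglex vle m' m) -> leading vle p = m.
Proof.
move=> mp max_m; apply/eqP/negPn/negP => nm.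
have nz_p : p != 0 by rewrite -msupp_eq0; case: (msupp p) mp.
have l1 := max_m _ (leading_supp nz_p) nm.
by case/negP: (deglex_asym l1); apply: leading_max; rewrite // eq_sym.
Qed.

End Leading.

(** A monomial only dominates monomials of at most its degree, which are finitely many; the
    induction is on the number of those below it. *)
Lemma deglex_wf : well_founded (fun m1 m2 => deglex vle m1 m2).
Proof.
have wf_n n : forall m, (mdeg m < n)%N -> Acc (fun m1 m2 => deglex vle m1 m2) m.
  elim: n => [m|n _]; first by rewrite ltn0.
  pose S m := [set k : 'X_{1..#|V| < n.+1} | deglex vle k m].
  move=> m; move: {2}#|S m|.+1 (ltnSn #|S m|) => c.
  elim: c m => [m|c IHc m]; first by rewrite ltn0.
  rewrite ltnS => leSc ltmn.
  constructor => m' l; have ltm'n : (mdeg m' < n.+1)%N.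
    by apply: leq_ltn_trans ltmn; case/deglexP: (l) => [/ltnW|[->]].
  apply: IHc => //; apply: leq_trans leSc; apply: proper_card.
  rewrite properE; apply/andP; split.
    by apply/subsetP => k; rewrite !inE => /deglex_trans; apply.
  apply/subsetPn; exists (BMultinom ltm'n); first by rewrite inE.
  by rewrite inE deglex_irr.
by move=> m; apply: (wf_n (mdeg m).+1).
Qed.

End DegLex.

(** * Counting normal families *)

Section NormalFamilies.

Variables (d : Order.disp_t) (E : finOrderType d).
Implicit Types (T F U : {set E}) (A : {set {set E}}) (m n i : E).

Definition is_max T m := (m \in T) && [forall x in T, (x <= m)%O].

Lemma is_maxP T m : reflect (m \in T /\ forall x, x \in T -> (x <= m)%O) (is_max T m).
Proof.
apply: (iffP andP) => [[mT /forall_inP le_m]|[mT le_m]]; split=> //.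
exact/forall_inP.
Qed.

Lemma is_max_ex T : T != set0 -> exists m, is_max T m.
Proof.
case/set0Pn => x xT; case: (Order.TotalTheory.arg_maxP id xT) => m mT le_m.
by exists m; apply/is_maxP.
Qed.

Lemma is_max_uniq T m n : is_max T m -> is_max T n -> m = n.
Proof.
case/is_maxP=> mT le_m /is_maxP[nT le_n]; apply/eqP.
by rewrite eq_le le_m ?le_n.
Qed.

(* The two cases of [normal_pair], according to which set has the smaller
   maximum: [normal_pair T' T] in the first one, [normal_pair T T'] in the
   second one. *)
Definition compat T T' :=
  [exists m, exists n, [&& is_max T m, is_max T' n, (m < n)%O
    & (T \subset T') || [&& T' :&: [set i | (i <= m)%O] \subset T, m \notin T'
                          & (1 < #|T :\: T'|)%N]]].

Lemma compatP T T' :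
  reflect (exists m n, [/\ is_max T m, is_max T' n, (m < n)%O
    & T \subset T' \/ [/\ T' :&: [set i | (i <= m)%O] \subset T, m \notin T'
                         & (1 < #|T :\: T'|)%N]])
          (compat T T').
Proof.
apply: (iffP existsP) => -[m]; last first.
  case=> n [Tm T'n mn sub]; exists m; apply/existsP; exists n.
  rewrite Tm T'n mn /=; case: sub => [->//|[-> -> ->]]; exact: orbT.
case/existsP => n /and4P[Tm T'n mn sub]; exists m, n; split=> //.
by case/orP: sub => [->|/and3P]; [left|right].
Qed.

Definition compat_sym T T' := compat T T' || compat T' T.

Lemma compat_symC T T' : compat_sym T T' = compat_sym T' T.
Proof. by rewrite /compat_sym orbC. Qed.

(** These are the supports of the monomials with only normal pairs. Such monomials are squarefree,
    since compatible sets have distinct maxima. *)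
Definition families U : {set {set {set E}}} :=
  [set A : {set {set E}} | [forall T in A, (T \subset U) && (1 < #|T|)%N] &&
           [forall T in A, forall T' in A, (T != T') ==> compat_sym T T']].

Lemma familiesP U A :
  reflect [/\ forall T, T \in A -> T \subset U,
              forall T, T \in A -> (1 < #|T|)%N
            & forall T T', T \in A -> T' \in A -> T != T' -> compat_sym T T']
          (A \in families U).
Proof.
rewrite inE; apply: (iffP andP) => [[/forall_inP sA /forall_inP cA]|[sA lA cA]].
  split=> [T /sA/andP[]//|T /sA/andP[]//|T T' TA T'A nT].
  by move/forall_inP: (cA T TA) => /(_ T' T'A)/implyP; apply.
split; apply/forall_inP => T TA; first by rewrite sA ?lA.
by apply/forall_inP => T' T'A; apply/implyP; apply: cA.
Qed.

Lemma sum_powerset_card U (f : nat -> nat) :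
  \sum_(F in powerset U) f #|F| = \sum_(k < #|U|.+1) 'C(#|U|, k) * f k.
Proof.
rewrite (partition_big (fun F => inord #|F| : 'I_(#|U|.+1)) xpredT) //=.
apply: eq_bigr => k _; rewrite -cards_draws -sum1_card big_distrl /=.
have eq_ord F : F \subset U -> (inord #|F| == k :> 'I__) = (#|F| == k).
  by move=> sFU; rewrite -val_eqE /= inordK // ltnS subset_leq_card.
apply: congr_big => // [F|F].
  by rewrite !inE; case: (boolP (F \subset U)) => //= /eq_ord.
by rewrite inE => /andP[sFU]; rewrite eq_ord // => /eqP->; rewrite mul1n.
Qed.

Lemma sum_powerset_fact U :
  (\sum_(F in powerset U) #|F|`! * #|U :\: F|`! = #|U|.+1`!)%N.
Proof.
transitivity (\sum_(F in powerset U) #|F|`! * (#|U| - #|F|)`!)%N.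
  apply: eq_bigr => F; rewrite inE => sFU.
  by rewrite cardsD (setIidPr sFU).
rewrite (sum_powerset_card U (fun k => k`! * (#|U| - k)`!)%N).
rewrite (eq_bigr (fun=> #|U|`!)) => [|k _]; last by rewrite bin_fact -1?ltnS.
by rewrite sum_nat_const card_ord factS.
Qed.

Section Fibre.

Variables (U : {set E}) (n : E).
Hypothesis maxU : is_max U n.

(* Equal to [T :\ n] if [T] is the member of [A] containing [n], and to [set0] if
   there is no such member; the two cases are counted together. *)
Definition top_trace A : {set E} := \bigcup_(T in A | n \in T) (T :\ n).

(** Compatible sets have distinct maxima, so at most one member contains [n] and the union has at
    most one term. *)
Lemma top_traceE A T : A \in families U -> T \in A -> n \in T ->
  top_trace A = T :\ n.
Proof.
case/familiesP => sA _ cA TA nT; apply/eqP; rewrite eqEsubset; apply/andP; split.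
  apply/bigcupsP => T' /andP[T'A nT']; have [->//|neqT] := eqVneq T' T.
  have max_n S : S \in A -> n \in S -> is_max S n.
    move=> SA nS; apply/is_maxP; split=> // x xS.
    by case/is_maxP: maxU => _; apply; apply: (subsetP (sA _ SA)).
  by case/orP: (cA _ _ T'A TA neqT) => /compatP[p [q [pmax qmax]]];
    rewrite (is_max_uniq pmax (max_n _ _ _)) // (is_max_uniq qmax (max_n _ _ _)) // ltxx.
by apply: (bigcup_sup T) => //; apply/andP.
Qed.

Lemma top_trace_sub A : A \in families U -> top_trace A \subset U :\ n.
Proof.
case/familiesP => sA _ _; apply/bigcupsP => T /andP[TA _].
by apply: setSD; apply: sA.
Qed.

Lemma top_trace_neq0 A : A \in families U -> top_trace A != set0 ->
  n |: top_trace A \in A.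
Proof.
move=> fA /set0Pn[x /bigcupP[T /andP[TA nT] _]].
by rewrite (top_traceE fA TA nT) setD1K.
Qed.

(** Let F be the top trace, assumed nonempty. The member [n |: F] has the larger maximum and does
    not contain T, so the second alternative of [compat] applies: T meets F in the part of F below
    max T. *)
Lemma fibre_outside A T : A \in families U -> T \in A -> n \notin T ->
  ~~ (T \subset top_trace A) ->
  exists m, [/\ is_max T m, m \notin top_trace A,
    T :&: top_trace A = top_trace A :&: [set i | (i <= m)%O]
    & (1 < #|T :\: top_trace A|)%N].
Proof.
move=> fA TA nT nsub; case/familiesP: (fA) => sA lA cA.
have [F0|nF0] := eqVneq (top_trace A) set0.
  have [|m Tm] := @is_max_ex T; first by rewrite -card_gt0 (ltn_trans _ (lA T TA)).
  by exists m; rewrite F0 !inE setI0 set0I setD0 lA.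
have T0A := top_trace_neq0 fA nF0; move: (top_trace A) T0A nsub nF0 => F T0A nsub nF0.
have neqT : T != n |: F by apply: contraNneq nT => ->; rewrite setU11.
case/orP: (cA _ _ TA T0A neqT) => /compatP[p [q [/is_maxP[pmax lep] qmax pq]]]; last first.
  case/is_maxP: maxU => nU /(_ q); rewrite leNgt => /(_ (subsetP (sA _ TA) _ _)).
  case/is_maxP: qmax => qT _ /(_ qT); rewrite (le_lt_trans _ pq) //.
  by apply: lep; rewrite setU11.
case=> [sT0|[sT0 pT0 lT0]].
  case/subsetP: nsub => x xT; have := subsetP sT0 x xT.
  by rewrite !inE => /predU1P[exn|//]; rewrite -exn xT in nT.
exists p; split; first exact/is_maxP.
- by apply: contra pT0 => pF; rewrite setU1r.
- apply/setP => x; rewrite !inE; apply/andP/andP => [[xT xF]|[xF xp]].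
    by rewrite xF lep.
  by rewrite xF (subsetP sT0) // !inE xF xp orbT.
- apply: leq_trans lT0 (subset_leq_card _).
  by apply: setDS; apply: subsetUr.
Qed.

Definition fibre_map F A : {set {set E}} * {set {set E}} :=
  (A :&: powerset F,
   [set T :\: F | T in A & (n \notin T) && ~~ (T \subset F)]).

(** Both maxima lie outside the top trace F and survive its removal. Inside F the two sets are the
    parts of F below their maxima, so the first lies in the second there and T1 minus T2 loses
    nothing. *)
Lemma compat_setD A T1 T2 : A \in families U -> T1 \in A -> T2 \in A ->
    n \notin T1 -> n \notin T2 ->
    ~~ (T1 \subset top_trace A) -> ~~ (T2 \subset top_trace A) ->
  compat T1 T2 -> compat (T1 :\: top_trace A) (T2 :\: top_trace A).
Proof.
move=> fA T1A T2A nT1 nT2 ns1 ns2.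
case: (fibre_outside fA T1A nT1 ns1) => p1 [max1 p1F tr1 l1].
case: (fibre_outside fA T2A nT2 ns2) => p2 [max2 p2F tr2 l2].
move: (top_trace A) p1F p2F tr1 tr2 l1 l2 {ns1 ns2} => F p1F p2F tr1 tr2 l1 l2.
case/compatP=> m1 [m2 [max1' max2']].
rewrite -{max1'}(is_max_uniq max1 max1') -{max2'}(is_max_uniq max2 max2') => p12 sub.
have maxD T p : is_max T p -> p \notin F -> is_max (T :\: F) p.
  case/is_maxP => pT lep pF; apply/is_maxP; rewrite inE pF pT; split=> // x.
  by rewrite inE => /andP[_ /lep].
apply/compatP; exists p1, p2; split; rewrite ?maxD //.
case: sub => [s12|[s12 p1T2 l12]]; [by left; apply: setSD|right].
split; last 1 first.
- suff -> : T1 :\: F :\: (T2 :\: F) = T1 :\: T2 by [].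
  apply/setP => x; rewrite !inE; case xF: (x \in F) => //=.
  case xT1: (x \in T1); rewrite ?andbF // andbT.
  suff: x \in T2 by move->.
  have /setIP[] // : x \in T2 :&: F.
  have /setIP[_] : x \in F :&: [set i | (i <= p1)%O] by rewrite -tr1 inE xT1.
  by rewrite tr2 !inE xF => /le_trans/(_ (ltW p12)).
- apply/subsetP => x; rewrite !inE => /andP[/andP[-> xT2] xp1] /=.
  by rewrite (subsetP s12) // !inE xT2.
- by rewrite !inE negb_and p1T2 orbT.
Qed.

Lemma fibre_map_sub F A : A \in families U -> top_trace A = F ->
  fibre_map F A \in setX (families F) (families (U :\ n :\: F)).
Proof.
move=> fA trF; case/familiesP: (fA) => sA lA cA.
rewrite inE; apply/andP; split; apply/familiesP; split=> /=.
- by move=> T /setIP[_]; rewrite inE.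
- by move=> T /setIP[/lA].
- by move=> T T' /setIP[TA _] /setIP[T'A _]; apply: cA.
- move=> _ /imsetP[T + ->]; rewrite inE => /and3P[TA nT _]; apply: setSD.
  by rewrite subsetD1 sA.
- move=> _ /imsetP[T + ->]; rewrite inE -trF => /and3P[TA nT nsT].
  by case: (fibre_outside fA TA nT nsT) => m [].
move=> _ _ /imsetP[T + ->] /imsetP[T' + ->].
rewrite !inE => /and3P[TA nT nsT] /and3P[T'A nT' nsT'] neq.
have /(cA _ _ TA T'A) : T != T' by apply: contra_neq neq => ->.
rewrite -trF in nsT nsT' *.
by case/orP => /compat_setD c; apply/orP; [left|right]; apply: c.
Qed.

(** The member containing [n] is [n |: F], the members inside F form the first component, and any
    other member T is recovered from T minus F: its maximum is visible there and cuts out its trace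
    on F. *)
Lemma fibre_map_inj F :
  {in [set A in families U | top_trace A == F] &, injective (fibre_map F)}.
Proof.
suff sub A A' : A \in families U -> A' \in families U -> top_trace A = F ->
    top_trace A' = F -> fibre_map F A = fibre_map F A' -> A \subset A'.
  move=> A A' /setIdP[fA /eqP hA] /setIdP[fA' /eqP hA'] eqA.
  by apply/eqP; rewrite eqEsubset !sub.
move=> fA fA' hA hA' [eq1 eq2]; apply/subsetP => T TA.
have [nT|nT] := boolP (n \in T).
  have eTF := top_traceE fA TA nT; rewrite hA in eTF.
  have nF0 : top_trace A' != set0.
    rewrite hA' eTF -card_gt0 -ltnS; case/familiesP: fA => _ /(_ T TA).
    by rewrite (cardsD1 n T) nT.
  by have := top_trace_neq0 fA' nF0; rewrite hA' eTF setD1K.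
have [sT|nsT] := boolP (T \subset F).
  have : T \in A :&: powerset F by rewrite !inE TA.
  by rewrite eq1 => /setIP[].
have : T :\: F \in [set T :\: F | T in A & (n \notin T) && ~~ (T \subset F)].
  by apply/imsetP; exists T => //=; rewrite !inE TA nT.
rewrite eq2 => /imsetP[T']; rewrite inE => /and3P[T'A nT' nsT'] eqD.
rewrite -hA in nsT; case: (fibre_outside fA TA nT nsT) => m.
rewrite -hA' in nsT'; case: (fibre_outside fA' T'A nT' nsT') => m'.
rewrite hA hA' => -[max' mF' tr' _] [max mF tr _].
have maxD S p : is_max S p -> p \notin F -> is_max (S :\: F) p.
  case/is_maxP => pS lep pF; apply/is_maxP; rewrite inE pF pS; split=> // x.
  by rewrite inE => /andP[_ /lep].
have emm : m = m'.
  by apply: is_max_uniq (maxD _ _ max mF) _; rewrite eqD; apply: maxD.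
by rewrite -(setID T F) tr eqD emm -tr' setID.
Qed.

End Fibre.

(** Sorting the families by their top trace, a subset of U minus its greatest element, bounds their
    number by the sum evaluated in [sum_powerset_fact]. *)
Lemma card_families U : (#|families U| <= #|U|`!)%N.
Proof.
move: {2}#|U|.+1 (ltnSn #|U|) => k; elim: k U => [U|k IHk U]; first by rewrite ltn0.
have [-> _|nU0 ltUk] := eqVneq U set0.
  rewrite cards0 fact0 -(cards1 (set0 : {set {set E}})); apply: subset_leq_card.
  apply/subsetP => A /familiesP[sA lA _]; rewrite inE -subset0; apply/subsetP => T TA.
  by have := lA T TA; have := sA T TA; rewrite subset0 => /eqP->; rewrite cards0.
have [n maxU] := is_max_ex nU0; have /is_maxP[nU _] := maxU.
have eUn : #|U| = #|U :\ n|.+1 by rewrite (cardsD1 n) nU.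
rewrite eUn -sum_powerset_fact -sum1_card.
rewrite (partition_big (top_trace n) (mem (powerset (U :\ n)))) /=; last first.
  by move=> A /(top_trace_sub n); rewrite inE.
apply: leq_sum => F; rewrite inE => sFU.
rewrite sum1dep_card -(card_in_imset (@fibre_map_inj _ _ maxU F)).
have sF k' : (k' <= #|U :\ n|)%N -> (k' < k)%N.
  by move=> /leq_ltn_trans; apply; rewrite -ltnS -eUn.
apply: leq_trans (_ : #|families F| * #|families (U :\ n :\: F)| <= _)%N; last first.
  by apply: leq_mul; apply: IHk; apply: sF; apply: subset_leq_card => //; apply: subsetDl.
rewrite -cardsX; apply: subset_leq_card; apply/subsetP => B /imsetP[A].
by move=> /setIdP[fA /eqP hA] ->; apply: (fibre_map_sub maxU).
Qed.

End NormalFamilies.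

(** * Normal pairs *)

Section SetMax.

Variables (d : Order.disp_t) (E : finOrderType d).

Lemma is_max_setmax (F : neset E) : is_max (val F) (setmax F).
Proof.
rewrite /setmax; case: (Order.TotalTheory.arg_maxP id) => [|m mF le_m]; last by apply/is_maxP.
exact: xchooseP.
Qed.

Lemma setmax_in (F : neset E) : setmax F \in val F.
Proof. by case/is_maxP: (is_max_setmax F). Qed.

Lemma setmax_ge (F : neset E) x : x \in val F -> (x <= setmax F)%O.
Proof. by case/is_maxP: (is_max_setmax F) => _; apply. Qed.

Lemma is_max_setmaxE (F : neset E) m : is_max (val F) m -> setmax F = m.
Proof. exact: is_max_uniq (is_max_setmax F). Qed.

Lemma normal_pair_compat (S1 S2 : neset E) :
  normal_pair S1 S2 -> compat_sym (val S1) (val S2).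
Proof.
case=> -[l1 _] [init_S1 _ min_S1] gap.
have m1S2 : setmax S1 \notin val S2.
  (* Otherwise S1 without its maximum would be a smaller initial segment that still covers the union
     together with S2. *)
  apply/negP => m1S2; pose I := val S1 :\ setmax S1.
  have nI0 : I != set0 by rewrite -card_gt0 -ltnS; move: l1; rewrite (cardsD1 (setmax S1)) setmax_in.
  have IE : I = val S1 :&: [set i | (i <= setmax (Sub I nI0 : neset E))%O].
    have := setmax_in (Sub I nI0 : neset E); rewrite !inE => /andP[nmax maxS1].
    apply/setP => x; rewrite !inE; apply/andP/andP => [[nx xS1]|[xS1 xI]].
      by split=> //; apply: (@setmax_ge (Sub I nI0 : neset E)); rewrite !inE nx.
    split=> //; apply: contraNneq nmax => ex.
    by rewrite eq_le (setmax_ge maxS1) -ex.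
  suff /subsetP/(_ _ (setmax_in S1)) : val S1 \subset I by rewrite !inE eqxx.
  apply: (min_S1 (Sub I nI0)); rewrite /initial_segment /=.
  - rewrite {1}IE {1}init_S1 /= -setIA; congr (_ :&: _); apply/setP => x.
    rewrite !inE; case: (leP x (setmax (Sub I nI0 : neset E))); rewrite ?andbF // andbT.
    move/le_trans; apply; apply: setmax_ge.
    by have := setmax_in (Sub I nI0 : neset E); rewrite inE => /andP[].
  - apply/setP => x; rewrite !inE; have [->|] := eqVneq x (setmax S1); last by [].
    by rewrite m1S2 !orbT.
rewrite /compat_sym; case: (ltgtP (setmax S1) (setmax S2)) => [lt12|lt21|e12].
- apply/orP; left; apply/compatP; exists (setmax S1), (setmax S2).
  split; rewrite ?is_max_setmax //; right; split=> //.
    rewrite init_S1 /=; apply: setSI; exact: subsetUr.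
  have -> : val S1 :\: val S2 = val (neset_setU S1 (val S2)) :\: val S2.
    by rewrite /= setDUl setDv setU0.
  (* The exempted case of the last condition is excluded: max S2 is here the maximum of the union,
     so S2 is not the union minus its maximum. *)
  apply: gap => eS2; have : setmax S2 \in val S2 := setmax_in S2.
  rewrite eS2 => /setD1P[/eqP ne _]; apply: ne; apply/esym/is_max_setmaxE.
  apply/is_maxP; rewrite inE setmax_in orbT; split=> // x; rewrite inE.
  by case/orP => /setmax_ge // /le_trans; apply; apply: ltW.
- apply/orP; right; apply/compatP; exists (setmax S2), (setmax S1).
  split; rewrite ?is_max_setmax //; left; rewrite init_S1 /=; apply/subsetP => x xS2.
  by rewrite !inE xS2 orbT (le_trans (setmax_ge xS2)) // ltW.
- by rewrite e12 setmax_in in m1S2.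
Qed.

Lemma compat_normal_pair (S1 S2 : bigset E) : compat (val S1) (val S2) ->
  normal_pair (bigset_ne S1) (bigset_ne S2) \/
  normal_pair (bigset_ne S2) (bigset_ne S1).
Proof.
case/compatP => m1 [m2 [max1 max2 lt12]].
have em1 : setmax (bigset_ne S1) = m1 by apply: is_max_setmaxE.
have em2 : setmax (bigset_ne S2) = m2 by apply: is_max_setmaxE.
case/is_maxP: (max1) => m1S1 le_m1; case/is_maxP: (max2) => m2S2 le_m2.
case=> [s12|[s12 m1S2 l12]]; [right|left].
  (* The pair is taken in the order (S2, S1). The union is S2, and an initial segment that covers it
     with S1 must reach [m2], which is not in S1. *)
  have m2S1 : m2 \notin val S1 by apply/negP => /le_m1; rewrite leNgt lt12.
  have eU : val S2 :|: val S1 = val S2 by apply/setUidPl.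
  split=> [||ne] /=; first by split; [apply: (valP S2)|apply: (valP S1)].
    split=> // [|I init_I eI] /=; rewrite /initial_segment /= ?eU.
      rewrite em2; apply/setP => x; rewrite !inE.
      by case xS2: (x \in _) => //=; rewrite le_m2.
    have m2I : m2 \in val I.
      by move/setP/(_ m2): eI; rewrite !inE m2S2 (negPf m2S1) orbF.
    rewrite init_I /= eU; apply/subsetP => x xS2; rewrite !inE xS2 /=.
    by apply: le_trans (le_m2 _ xS2) _; apply: setmax_ge.
  rewrite eU ltnNge; apply/negP => le1; case: ne => /=.
  have sD : [set m2] \subset val S2 :\: val S1 by rewrite sub1set inE m2S1.
  have emax : setmax (neset_setU (bigset_ne S2) (val S1)) = m2.
    by apply: is_max_setmaxE; rewrite /= eU.
  have eD : val S2 :\: val S1 = [set m2].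
    by apply/esym/eqP; rewrite eqEcard sD cards1.
  by rewrite emax eU -eD setDDr setDv set0U; apply/esym/setIidPr.
have emaxU : setmax (neset_setU (bigset_ne S1) (val S2)) = m2.
  apply: is_max_setmaxE; apply/is_maxP; rewrite inE m2S2 orbT; split=> // x.
  by rewrite inE => /orP[/le_m1 /le_trans->//|/le_m2//]; apply: ltW.
split=> [||_] /=; first by split; [apply: (valP S1)|apply: (valP S2)].
  split=> // [|I init_I eI] /=.
    rewrite /initial_segment /= em1; apply/setP => x; rewrite !inE.
    apply/idP/andP => [xS1|[/orP[//|xS2] xm1]]; first by rewrite xS1 le_m1.
    by apply: (subsetP s12); rewrite !inE xS2.
  have m1I : m1 \in val I.
    by move/setP/(_ m1): eI; rewrite !inE m1S1 (negPf m1S2) orbF.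
  rewrite init_I /=; apply/subsetP => x xS1; rewrite !inE xS1 /=.
  by apply: le_trans (le_m1 _ xS1) _; apply: setmax_ge.
by rewrite setDUl setDv setU0.
Qed.

Lemma compat_sym_normal_pair (S1 S2 : bigset E) :
  compat_sym (val S1) (val S2) <->
  normal_pair (bigset_ne S1) (bigset_ne S2) \/
  normal_pair (bigset_ne S2) (bigset_ne S1).
Proof.
split; last by case=> /normal_pair_compat //; rewrite compat_symC.
by case/orP => /compat_normal_pair //; case; [right|left].
Qed.

End SetMax.

(** * Relations in the Chow ring *)

Section ChowRelations.

Variable E : finType.
Local Open Scope ring_scope.
Local Open Scope quotient_scope.

Lemma chow_pi_is_zmod_morphism : zmod_morphism (@chow_pi E).
Proof. by move=> p q; rewrite /chow_pi rmorphB. Qed.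

HB.instance Definition _ :=
  GRing.isZmodMorphism.Build _ _ (@chow_pi E) chow_pi_is_zmod_morphism.

Lemma chow_pi_is_monoid_morphism : monoid_morphism (@chow_pi E).
Proof. by split=> [|p q]; rewrite /chow_pi ?rmorph1 ?rmorphM. Qed.

HB.instance Definition _ :=
  GRing.isMonoidMorphism.Build _ _ (@chow_pi E) chow_pi_is_monoid_morphism.

Lemma chow_pi_eq0 p : (chow_pi p = 0) <-> chow_ideal (E := E) p.
Proof.
have -> : chow_ideal p = (p - 0 \in chow_idealr E) by rewrite subr0.
rewrite Quotient.idealrBE.
by rewrite -(rmorph0 (@chow_pi E)); split=> [e|/eqP e]; [apply/eqP|].
Qed.

Lemma ideal_gen_mem (R : comNzRingType) (G : R -> Prop) p : G p -> ideal_gen G p.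
Proof.
exists [:: (1, p)]; last by rewrite big_seq1 mul1r.
by move=> c; rewrite inE => /eqP->.
Qed.

Lemma chow_x_linear (i : E) : \sum_(F : neset E | i \in val F) chow_x F = 0.
Proof.
rewrite -rmorph_sum; apply/chow_pi_eq0/asboolP.
exists (\sum_(F : neset E | i \in val F) pvar rat F), 0; rewrite addr0.
by split=> //; [apply: ideal_gen_mem; exists i|apply: ideal_gen0].
Qed.

Lemma chow_x_mul0 (F1 F2 : neset E) :
  ~~ (val F1 \subset val F2) -> ~~ (val F2 \subset val F1) ->
  chow_x F1 * chow_x F2 = 0.
Proof.
move=> n12 n21; rewrite -rmorphM; apply/chow_pi_eq0/asboolP.
exists 0, (pvar rat F1 * pvar rat F2); rewrite add0r.
by split=> //; [apply: ideal_gen0|apply: ideal_gen_mem; exists F1, F2].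
Qed.

(* The pullback of [x_A] from the boolean matroid on [U] when [A] is a nonempty
   subset of [U]. *)
Definition chow_xtrace (U A : {set E}) : chow E :=
  \sum_(F : neset E | val F :&: U == A) chow_x F.

(** If F has trace A on U and G has trace B on V, then G has trace [B :&: U] on U; F and G are
    incomparable because their traces on U are. *)
Lemma chow_xtrace_mul0 (U V A B : {set E}) : U \subset V ->
    ~~ (A \subset B :&: U) -> ~~ (B :&: U \subset A) ->
  chow_xtrace U A * chow_xtrace V B = 0.
Proof.
move=> sUV nAB nBA; rewrite /chow_xtrace big_distrl /= big1 // => F /eqP FA.
rewrite big_distrr /= big1 // => G /eqP GB.
have GU : val G :&: U = B :&: U by rewrite -GB -setIA (setIidPr sUV).
apply: chow_x_mul0; first by apply: contra nAB => sFG; rewrite -GU -FA setSI.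
by apply: contra nBA => sGF; rewrite -GU -FA setSI.
Qed.

Lemma chow_xtrace_linear (U : {set E}) i : i \in U ->
  \sum_(A : {set E} | (A \subset U) && (i \in A)) chow_xtrace U A = 0.
Proof.
move=> iU; rewrite -[RHS](chow_x_linear i); symmetry.
rewrite (partition_big (fun F : neset E => val F :&: U)
  (fun A : {set E} => (A \subset U) && (i \in A))) /=; last first.
  by move=> F iF; rewrite subsetIr inE iF.
apply: eq_bigr => A /andP[sAU iA]; apply: eq_bigl => F.
apply/andP/idP => [[]//|/eqP FA]; split; last exact/eqP.
by move: iA; rewrite -FA inE => /andP[].
Qed.

Lemma chow_xtraceD1 (U A : {set E}) p : p \in U -> p \notin A ->
  chow_xtrace (U :\ p) A = chow_xtrace U A + chow_xtrace U (p |: A).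
Proof.
move=> pU pA; rewrite /chow_xtrace (bigID (fun F : neset E => p \in val F)) /= addrC.
congr (_ + _); apply: eq_bigl => F.
  apply/andP/eqP => [[/eqP <- pF]|FA].
    apply/setP => x; rewrite !inE; have [->|//] := eqVneq x p.
    by rewrite (negPf pF).
  have pF : p \notin val F by apply: contra pA => pF; rewrite -FA inE pF.
  split=> //; apply/eqP; rewrite -FA; apply/setP => x; rewrite !inE.
  by have [->|//] := eqVneq x p; rewrite (negPf pF).
apply/andP/eqP => [[/eqP <- pF]|FA].
  apply/setP => x; rewrite !inE; have [->|//] := eqVneq x p.
  by rewrite pF pU.
split; last by have : p \in p |: A := setU11 _ _; rewrite -FA => /setIP[].
by rewrite setIDA FA setU1K.
Qed.

End ChowRelations.

(** * The simplicial generators and their presentation map *)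

Section SimplicialGenerators.

Variables (d : Order.disp_t) (E : finOrderType d).
Local Open Scope ring_scope.

Definition down_to (p : E) : {set E} := [set i | (i <= p)%O].

Lemma chow_gE (F : neset E) : chow_g F = chow_xtrace (down_to (setmax F)) (val F).
Proof.
rewrite /chow_g /chow_xtrace; symmetry.
have notin_le x : (x \in val F) -> (setmax F < x)%O = false.
  by move/setmax_ge => le; rewrite ltNge le.
rewrite (reindex_onto (neset_setU F) (fun G => val G :\: down_to (setmax F))) /=.
  apply: eq_bigl => S; apply/andP/subsetP => [[_ /eqP<-] x|sS].
    by rewrite !inE ltNge => /andP[].
  split; apply/eqP/setP => x; rewrite !inE.
    case xF: (x \in val F) => /=; first by rewrite setmax_ge.
    by apply/negP => /andP[/sS]; rewrite inE ltNge => /negPf->.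
  case xF: (x \in val F) => /=.
    by rewrite setmax_ge //=; apply/esym/negP => /sS; rewrite inE notin_le.
  rewrite -ltNge; case xS: (x \in S); rewrite ?andbF // andbT.
  by have := sS _ xS; rewrite inE.
move=> G /eqP GF; apply/val_inj => /=; apply/setP => x; rewrite !inE.
have /setP/(_ x) := GF; rewrite !inE => <-.
by case: (x \in val G); case: (x <= setmax F)%O.
Qed.

Implicit Types p q : {mpoly rat[#|bigset E|]}.

(** The substitution before passing to the quotient: it shows that [ss_morphism] is a ring morphism,
    and it can be evaluated at orderings. *)
Definition ss_lift : {mpoly rat[#|bigset E|]} -> {mpoly rat[#|neset E|]} :=
  mmap (@mpolyC _ rat) (fun i : 'I_#|bigset E| =>
    let F := bigset_ne (enum_val i) in
    \sum_(S : {set E} | S \subset [set i | (setmax F < i)%O]) pvar rat (neset_setU F S)).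

HB.instance Definition _ := GRing.RMorphism.on ss_lift.

Lemma ss_morphismE p : ss_morphism p = chow_pi (ss_lift p).
Proof.
rewrite /ss_morphism /ss_lift /mmap rmorph_sum; apply: eq_bigr => m _.
rewrite rmorphM; congr (_ * _); rewrite /mmap1 rmorph_prod; apply: eq_bigr => i _.
by rewrite rmorphXn rmorph_sum.
Qed.

Lemma ss_morphism_is_zmod_morphism : zmod_morphism (@ss_morphism d E).
Proof. by move=> p q; rewrite !ss_morphismE !rmorphB. Qed.

HB.instance Definition _ :=
  GRing.isZmodMorphism.Build _ _ (@ss_morphism d E) ss_morphism_is_zmod_morphism.

Lemma ss_morphism_is_monoid_morphism : monoid_morphism (@ss_morphism d E).
Proof. by split=> [|p q]; rewrite !ss_morphismE ?rmorph1 ?rmorphM. Qed.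

HB.instance Definition _ :=
  GRing.isMonoidMorphism.Build _ _ (@ss_morphism d E) ss_morphism_is_monoid_morphism.

Lemma ss_morphism_mvar (v : bigset E) :
  ss_morphism 'X_[mvar v] = chow_g (bigset_ne v).
Proof.
rewrite ss_morphismE /ss_lift mmapX mmap1U enum_rankK rmorph_sum.
exact: eq_bigr.
Qed.

End SimplicialGenerators.

(** * Rewriting quadratic monomials *)

Section Spans.

Variables (d : Order.disp_t) (E : finOrderType d).
Local Open Scope ring_scope.
Local Notation mon := 'X_{1..#|bigset E|}.
Implicit Types (Q : mon -> Prop) (z : chow E) (A B U : {set E}).

Definition ss_span Q z : Prop :=
  exists2 r, forall m, m \in msupp r -> Q m & @ss_morphism d E r = z.

Lemma ss_span0 Q : ss_span Q 0.
Proof. by exists 0; rewrite ?rmorph0 // => m; rewrite msupp0. Qed.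

Lemma ss_spanD Q z1 z2 : ss_span Q z1 -> ss_span Q z2 -> ss_span Q (z1 + z2).
Proof.
move=> [r1 Q1 <-] [r2 Q2 <-]; exists (r1 + r2); last by rewrite rmorphD.
by move=> m /msuppD_le; rewrite mem_cat => /orP[/Q1|/Q2].
Qed.

Lemma ss_spanN Q z : ss_span Q z -> ss_span Q (- z).
Proof.
move=> [r Qr <-]; exists (- r); last by rewrite rmorphN.
by move=> m; rewrite (perm_mem (msuppN r)) => /Qr.
Qed.

Lemma ss_span_sum Q (I : Type) (s : seq I) (P : pred I) (z : I -> chow E) :
  (forall i, P i -> ss_span Q (z i)) -> ss_span Q (\sum_(i <- s | P i) z i).
Proof.
move=> Qz; elim/big_rec: _ => [|i y Pi Qy]; first exact: ss_span0.
by apply: ss_spanD => //; apply: Qz.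
Qed.

Lemma ss_spanM Q1 Q2 Q z1 z2 :
    (forall m1 m2, Q1 m1 -> Q2 m2 -> Q (m1 + m2)%MM) ->
  ss_span Q1 z1 -> ss_span Q2 z2 -> ss_span Q (z1 * z2).
Proof.
move=> Q12 [r1 Qr1 <-] [r2 Qr2 <-]; exists (r1 * r2); last by rewrite rmorphM.
by move=> m /msuppM_le /allpairsP[[m1 m2] [/Qr1 q1 /Qr2 q2 ->]]; apply: Q12.
Qed.

Lemma ss_span_g Q (v : bigset E) : Q (mvar v) -> ss_span Q (chow_g (bigset_ne v)).
Proof.
move=> Qv; exists 'X_[mvar v]; last exact: ss_morphism_mvar.
by move=> m; rewrite msuppX inE => /eqP->.
Qed.

Definition letter_in (P : bigset E -> Prop) (m : mon) : Prop :=
  exists2 v, P v & m = mvar v.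

Lemma ss_span_letter (P : bigset E -> Prop) (v : bigset E) :
  P v -> ss_span (letter_in P) (chow_g (bigset_ne v)).
Proof. by move=> Pv; apply: ss_span_g; exists v. Qed.

Lemma ss_span_letter_mul (P1 P2 : bigset E -> Prop) Q z1 z2 :
    (forall v w, P1 v -> P2 w -> Q (mvar v + mvar w)%MM) ->
  ss_span (letter_in P1) z1 -> ss_span (letter_in P2) z2 -> ss_span Q (z1 * z2).
Proof.
by move=> PQ; apply: ss_spanM => _ _ [v Pv ->] [w Pw ->]; apply: PQ.
Qed.

Lemma chow_xtrace_g (p : E) (A : {set E}) : A \subset down_to p -> p \in A ->
    (1 < #|A|)%N ->
  exists2 v : bigset E, val v = A /\ setmax (bigset_ne v) = p
                      & chow_xtrace (down_to p) A = chow_g (bigset_ne v).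
Proof.
move=> sAp pA lA; have maxE : setmax (bigset_ne (Sub A lA)) = p.
  apply: is_max_setmaxE; apply/is_maxP; split=> // x /(subsetP sAp).
  by rewrite inE.
by exists (Sub A lA) => //; rewrite chow_gE maxE.
Qed.

Definition down_closed (U : {set E}) : Prop :=
  forall x y, x \in U -> (y <= x)%O -> y \in U.

Lemma down_closed_max (U : {set E}) p : down_closed U -> is_max U p ->
  U = down_to p.
Proof.
move=> dU /is_maxP[pU le_p]; apply/setP => x; rewrite inE.
by apply/idP/idP => [/le_p|/(dU _ _ pU)].
Qed.

Lemma down_closedD1 p : down_closed (down_to p :\ p).
Proof.
move=> x y; rewrite !inE => /andP[nxp xp] yx.
rewrite (le_trans yx xp) andbT; apply: contraNneq nxp => eyp.
by rewrite eq_le xp -eyp yx.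
Qed.

Lemma chow_xtrace_top (p : E) (A : {set E}) : A \subset down_to p -> p \in A ->
  ss_span (letter_in (fun v => setmax (bigset_ne v) = p)) (chow_xtrace (down_to p) A).
Proof.
move=> sAp pA.
have big_case B : B \subset down_to p -> p \in B -> (1 < #|B|)%N ->
    ss_span (letter_in (fun v => setmax (bigset_ne v) = p)) (chow_xtrace (down_to p) B).
  move=> sB pB lB; case: (chow_xtrace_g sB pB lB) => v [_ maxv ->].
  exact: ss_span_letter.
have [lA|] := ltnP 1 #|A|; first exact: big_case.
rewrite leq_eqVlt ltnS leqn0 cards_eq0 orbC => /orP[/eqP A0|/cards1P[x Ax]].
  by rewrite A0 inE in pA.
have {x Ax} -> : A = [set p] by move: pA; rewrite Ax inE => /eqP->.
have sp : [set p] \subset down_to p by rewrite sub1set inE.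
(* The singleton of [p] is not a letter; the linear relation at [p] replaces it by minus the sum
   over the larger sets containing [p]. *)
have := @chow_xtrace_linear E (down_to p) p; rewrite inE lexx => /(_ isT).
rewrite (bigD1 [set p]) /=; last by rewrite sp set11.
move/eqP; rewrite addr_eq0 => /eqP->; apply: ss_spanN; apply: ss_span_sum => B.
case/andP=> /andP[sB pB] nB; apply: big_case => //.
rewrite (cardsD1 p) pB ltnS card_gt0; apply: contraNneq nB => B0.
by rewrite -(setD1K pB) B0 setU0.
Qed.

Lemma chow_xtrace_span (U A : {set E}) : down_closed U -> A \subset U ->
    A != set0 ->
  ss_span (letter_in (fun v => val v \subset U)) (chow_xtrace U A).
Proof.
move: {2}#|U|.+1 (ltnSn #|U|) => k; elim: k U A => [U A|k IHk U A]; first by rewrite ltn0.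
rewrite ltnS => leUk dU sAU nA0.
have nU0 : U != set0 by apply: contraNneq nA0 => U0; rewrite -subset0 -U0.
have [p Up] := is_max_ex nU0; have eU := down_closed_max dU Up.
have top B : B \subset U -> p \in B ->
    ss_span (letter_in (fun v => val v \subset U)) (chow_xtrace U B).
  rewrite eU => sB pB; case: (chow_xtrace_top sB pB) => r Qr <-.
  exists r => // m /Qr[v maxv ->]; exists v => //.
  by apply/subsetP => x; rewrite inE -maxv => xv; apply: setmax_ge.
have [pA|pA] := boolP (p \in A); first exact: top.
have pU : p \in U by case/is_maxP: Up.
(* If the greatest element [p] of U is not in A, the class is that of A on U minus [p], less a class
   whose set contains [p]. *)
have := chow_xtraceD1 pU pA => /eqP; rewrite -subr_eq => /eqP<-.
apply: ss_spanD; last first.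
  by apply: ss_spanN; apply: top; rewrite ?setU11 // subUset sub1set pU.
case: (IHk (U :\ p) A) => // [|||r Qr <-].
- by apply: leq_trans leUk; rewrite [leqRHS](cardsD1 p) pU.
- by rewrite eU; apply: down_closedD1.
- by rewrite subsetD1 sAU.
exists r => // m /Qr[v sv ->]; exists v => //.
by apply: subset_trans sv (subsetDl _ _).
Qed.

(* [A :\ p] and [B] are incomparable, hence the term [chow_xtrace _ (A :\ p)] of
   the pullback of [x_(A :\ p)] is killed by [chow_xtrace _ B]. *)
Lemma chow_xtrace_shift (p q : E) (A B : {set E}) : (p <= q)%O ->
    p \in A -> p \in B -> ~~ (A \subset B) ->
  chow_xtrace (down_to p) A * chow_xtrace (down_to q) B =
  chow_xtrace (down_to p :\ p) (A :\ p) * chow_xtrace (down_to q) B.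
Proof.
move=> pq pA pB nAB.
rewrite chow_xtraceD1 ?inE ?lexx ?eqxx // setD1K // mulrDl.
rewrite (chow_xtrace_mul0 (A := A :\ p)) ?add0r //.
- by apply/subsetP => x; rewrite !inE => /le_trans; apply.
- apply: contra nAB => /subsetP sAB; apply/subsetP => x xA.
  have [->//|nxp] := eqVneq x p.
  by have /sAB/setIP[] : x \in A :\ p by rewrite !inE nxp.
- by apply/negP => /subsetP/(_ p); rewrite !inE pB lexx eqxx => /(_ isT).
Qed.

End Spans.

(** * Reduction of the pairs that are not normal *)

Section Reductions.

Variables (d : Order.disp_t) (E : finOrderType d) (vle : rel (bigset E)).
Hypotheses (vle_refl : reflexive vle) (vle_anti : antisymmetric vle).
Hypotheses (vle_trans : transitive vle) (vle_total : total vle).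
Hypothesis vle_max : forall F1 F2 : bigset E,
  (setmax (bigset_ne F1) < setmax (bigset_ne F2))%O -> vlt vle F1 F2.
Hypothesis vle_sub : forall F1 F2 : bigset E,
  setmax (bigset_ne F1) = setmax (bigset_ne F2) ->
  val F2 \proper val F1 -> vlt vle F1 F2.
Local Open Scope ring_scope.

Definition below2 (m0 m : 'X_{1..#|bigset E|}) : Prop :=
  mdeg m = 2%N /\ deglex vle m m0.

Definition reducible (S1 S2 : bigset E) : Prop :=
  ss_span (below2 (mvar S1 + mvar S2)%MM)
    (chow_g (bigset_ne S1) * chow_g (bigset_ne S2)).

Lemma reducibleC S1 S2 : reducible S1 S2 -> reducible S2 S1.
Proof. by rewrite /reducible addmC mulrC. Qed.

Lemma mdeg_mvar2 (v w : bigset E) : mdeg (mvar v + mvar w)%MM = 2%N.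
Proof. by rewrite mdegD !mdeg_mvar. Qed.

Lemma below2_mono (S1 S2 v w : bigset E) : vlt vle v S1 -> w = S2 ->
  below2 (mvar S1 + mvar S2)%MM (mvar v + mvar w)%MM.
Proof.
by move=> vS1 ->; split; rewrite ?mdeg_mvar2 //; apply: deglex_mvar_add.
Qed.

Lemma letters_lt (S v : bigset E) :
  val v \subset down_to (setmax (bigset_ne S)) :\ setmax (bigset_ne S) ->
  vlt vle v S.
Proof.
move=> sv; apply: vle_max; have := subsetP sv _ (setmax_in (bigset_ne v)).
by rewrite !inE lt_neqAle.
Qed.

Lemma bigset_gt1 (S : bigset E) : (1 < #|val S|)%N.
Proof. exact: (valP S). Qed.

Lemma sub_down_to (S : bigset E) : val S \subset down_to (setmax (bigset_ne S)).
Proof. by apply/subsetP => x xS; rewrite inE; apply: (@setmax_ge _ _ (bigset_ne S)). Qed.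

(** Letters inside [down_to p :\ p] have maximum below [p], so they precede S; the set [val S :\ p]
    is nonempty since S has at least two elements. *)
Lemma span_lower (S : bigset E) :
  let p := setmax (bigset_ne S) in
  ss_span (letter_in (fun v => vlt vle v S)) (chow_xtrace (down_to p :\ p) (val S :\ p)).
Proof.
move=> p; have pS : p \in val S := setmax_in (bigset_ne S).
case: (@chow_xtrace_span _ _ (down_to p :\ p) (val S :\ p)) => [|||r Qr <-].
- exact: down_closedD1.
- by apply: setSD; apply: sub_down_to.
- by rewrite -card_gt0 -ltnS; have := bigset_gt1 S; rewrite (cardsD1 p) pS.
by exists r => // m /Qr[v /letters_lt vS ->]; exists v.
Qed.

Lemma reducible_shift (S1 S2 : bigset E) :
    (setmax (bigset_ne S1) <= setmax (bigset_ne S2))%O ->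
    setmax (bigset_ne S1) \in val S2 -> ~~ (val S1 \subset val S2) ->
  reducible S1 S2.
Proof.
move=> le12 pS2 n12; rewrite /reducible !chow_gE.
rewrite chow_xtrace_shift //; last exact: (setmax_in (bigset_ne S1)).
rewrite -chow_gE; apply: ss_span_letter_mul (span_lower S1) _; last first.
  by apply: (@ss_span_letter _ _ (fun w => w = S2)).
by move=> v w; apply: below2_mono.
Qed.

Lemma xtrace_below (S : bigset E) (p : E) (A : {set E}) :
    setmax (bigset_ne S) = p -> A \subset down_to p -> val S \proper A ->
  ss_span (letter_in (fun v => vlt vle v S)) (chow_xtrace (down_to p) A).
Proof.
move=> maxS sA SA; have pA : p \in A.
  by rewrite -maxS (subsetP (proper_sub SA)) // (setmax_in (bigset_ne S)).
have lA : (1 < #|A|)%N by apply: ltn_trans (bigset_gt1 S) (proper_card SA).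
case: (chow_xtrace_g sA pA lA) => v [vA maxv ->].
by apply: ss_span_letter; apply: vle_sub; rewrite ?maxS // vA.
Qed.

(** The linear relation at p rewrites g_S1 as minus the sum of the X_p(A) over the other A
    containing p. If A contains S1, its letter precedes S1. Otherwise A is incomparable with the
    trace of S2, because S1 is that trace together with p, and the product vanishes. *)
Lemma reducible_gap1 (S1 S2 : bigset E) :
    let p := setmax (bigset_ne S1) in
    (p <= setmax (bigset_ne S2))%O -> p \notin val S2 ->
    val S1 = p |: (val S2 :&: down_to p) ->
  reducible S1 S2.
Proof.
move=> p le12 pS2 eS1; have pS1 : p \in val S1 := setmax_in (bigset_ne S1).
have := @chow_xtrace_linear E (down_to p) p; rewrite inE lexx => /(_ isT).
rewrite (bigD1 (val S1)) /=; last by rewrite pS1 sub_down_to.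
move/eqP; rewrite addr_eq0 => /eqP eg.
rewrite /reducible [chow_g (bigset_ne S1)]chow_gE eg mulNr; apply: ss_spanN.
rewrite big_distrl /=; apply: ss_span_sum => A /andP[/andP[sA pA] nA].
have [sS1A|nS1A] := boolP (val S1 \subset A).
  apply: (ss_span_letter_mul (P1 := fun v => vlt vle v S1) (P2 := fun w => w = S2)).
  - by move=> v w; apply: below2_mono.
  - by apply: xtrace_below => //; rewrite properEneq sS1A eq_sym nA.
  - exact: ss_span_letter.
rewrite chow_gE chow_xtrace_mul0; first exact: ss_span0.
- by apply/subsetP => x; rewrite !inE => /le_trans; apply.
- by apply/negP => /subsetP/(_ p pA); rewrite inE (negPf pS2).
- by apply: contra nS1A => sBA; rewrite eS1 subUset sub1set pA.
Qed.

(** The linear relation at p = max S replaces one factor by the other sets A containing p. Those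
    containing S precede S. For the rest, the shift turns the remaining factor g_S into letters with
    maximum below p, and one such letter already makes the monomial smaller. *)
Lemma reducible_square (S : bigset E) : reducible S S.
Proof.
pose p := setmax (bigset_ne S); have pS : p \in val S := setmax_in (bigset_ne S).
have := @chow_xtrace_linear E (down_to p) p; rewrite inE lexx => /(_ isT).
rewrite (bigD1 (val S)) /=; last by rewrite pS sub_down_to.
move/eqP; rewrite addr_eq0 => /eqP eg; rewrite /reducible {1}chow_gE eg mulNr.
apply: ss_spanN; rewrite big_distrl /=; apply: ss_span_sum => A /andP[/andP[sA pA] nA].
have [sSA|nSA] := boolP (val S \subset A).
  apply: (ss_span_letter_mul (P1 := fun v => vlt vle v S) (P2 := fun w => w = S)).
  - by move=> v w; apply: below2_mono.
  - by apply: xtrace_below => //; rewrite properEneq sSA eq_sym nA.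
  - exact: ss_span_letter.
rewrite /= mulrC chow_gE chow_xtrace_shift // -/p.
apply: ss_span_letter_mul (span_lower S) (chow_xtrace_top sA pA).
by move=> v w vS _; split; rewrite ?mdeg_mvar2 //; apply: deglex_mvar2.
Qed.

(** Let p = max S1 be at most max S2, with S1 and S2 distinct. If p is in S2, a shift applies in one
    of the two orders; if the traces on U_p are incomparable, the product vanishes; in the remaining
    case S1 minus S2 is reduced to p. *)
Lemma reducible_not_compat (S1 S2 : bigset E) :
  ~~ compat_sym (val S1) (val S2) -> reducible S1 S2.
Proof.
wlog le12 : S1 S2 / (setmax (bigset_ne S1) <= setmax (bigset_ne S2))%O.
  move=> wl n12; case: (leP (setmax (bigset_ne S1)) (setmax (bigset_ne S2))) => [le|/ltW le].
    exact: wl.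
  by apply: reducibleC; apply: wl; rewrite // compat_symC.
move=> n12; pose p := setmax (bigset_ne S1).
have pS1 : p \in val S1 := setmax_in (bigset_ne S1).
move: le12; rewrite le_eqVlt => /orP[/eqP e12|lt12].
  have [<-|neq] := eqVneq S1 S2; first exact: reducible_square.
  have [s12|ns12] := boolP (val S1 \subset val S2); last first.
    by apply: reducible_shift; rewrite ?e12 // (setmax_in (bigset_ne S2)).
  apply: reducibleC; apply: reducible_shift; rewrite ?e12 //.
    by rewrite -e12.
  by apply: contra neq => s21; apply/eqP/val_inj/eqP; rewrite eqEsubset s12.
have ncompat : ~ (val S1 \subset val S2 \/
    [/\ val S2 :&: down_to p \subset val S1, p \notin val S2
      & (1 < #|val S1 :\: val S2|)%N]).
  move=> c; case/negP: n12; apply/orP; left; apply/compatP.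
  exists p, (setmax (bigset_ne S2)).
  by split=> //; [apply: (is_max_setmax (bigset_ne S1))|apply: (is_max_setmax (bigset_ne S2))].
have ns12 : ~~ (val S1 \subset val S2) by apply/negP => s12; apply: ncompat; left.
have [pS2|pS2] := boolP (p \in val S2).
  by apply: reducible_shift => //; apply: ltW.
have [sB|nsB] := boolP (val S2 :&: down_to p \subset val S1); last first.
  rewrite /reducible !chow_gE chow_xtrace_mul0 //; first exact: ss_span0.
    by apply/subsetP => x; rewrite !inE => /le_trans; apply; apply: ltW.
  by apply/negP => /subsetP/(_ p pS1); rewrite inE (negPf pS2).
apply: reducible_gap1; rewrite ?(ltW lt12) // -/p.
have le1 : (#|val S1 :\: val S2| <= 1)%N.
  by rewrite leqNgt; apply/negP => l1; apply: ncompat; right.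
have eD : val S1 :\: val S2 = [set p].
  by apply/esym/eqP; rewrite eqEcard sub1set inE pS1 pS2 cards1.
rewrite -eD -[LHS](setID (val S1) (val S2)) setUC; congr (_ :|: _).
apply/setP => x; rewrite !inE; apply/andP/andP => [[xS1 xS2]|[xS2 xp]].
  by split=> //; apply: (@setmax_ge _ _ (bigset_ne S1)).
by split=> //; apply: (subsetP sB); rewrite !inE xS2.
Qed.

Lemma quadratic_relation (S1 S2 : bigset E) :
    ~~ compat_sym (val S1) (val S2) ->
  exists q, [/\ @ss_ideal2 d E q, q != 0 & leading vle q = (mvar S1 + mvar S2)%MM].
Proof.
case/reducible_not_compat => r Qr er; set m0 := (_ + _)%MM in Qr *.
have coef0 : ('X_[m0] - r)@_m0 = 1.
  rewrite mcoeffB mcoeffX eqxx memN_msupp_eq0 ?subr0 //.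
  by apply/negP => /Qr[_]; rewrite deglex_irr.
have supp m : m \in msupp ('X_[m0] - r) -> m = m0 \/ below2 m0 m.
  move/msuppB_le; rewrite mem_cat msuppX inE => /orP[/eqP|/Qr]; by [left|right].
have m0s : m0 \in msupp ('X_[m0] - r) by rewrite mcoeff_msupp coef0 oner_neq0.
exists ('X_[m0] - r); split.
- split; last by apply/dhomogP => m /supp[->|[]//]; apply: mdeg_mvar2.
  by rewrite /ss_ideal rmorphB /= er mpolyXD rmorphM /= !ss_morphism_mvar subrr.
- by apply: contraTneq m0s => ->; rewrite msupp0.
- by apply: leadingP => // m /supp[->|[]//]; rewrite eqxx.
Qed.

End Reductions.

(** * Localization at orderings *)

Section Localization.

Variable E : finType.
Implicit Types (s : seq E) (F : {set E}).
Local Open Scope ring_scope.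

Definition weight (i : E) : rat := (enum_rank i).+1%:R.

Lemma weight_inj : injective weight.
Proof.
by move=> i j /eqP; rewrite eqr_nat eqSS => /eqP/val_inj/enum_rank_inj.
Qed.

Lemma weight_neq0 i : weight i != 0.
Proof. by rewrite pnatr_eq0. Qed.

(** The successor makes the indices below [size s] run over the nonempty prefixes, the full one
    included. *)
Definition prefix_set s k : {set E} := [set x in take k.+1 s].

(** At the last index the second term is the default value 0, so the gaps from any index to the end
    telescope to a single weight. *)
Definition gap s k : rat := (map weight s)`_k - (map weight s)`_k.+1.

(* The restriction of [x_F] to the torus-fixed point [s] of the permutohedral
   variety, at a rational point [weight] of the Lie algebra of the torus. *)
Definition xval s F : rat :=
  \sum_(k < size s) (prefix_set s k == F)%:R * gap s k.

Section Ordering.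

Variable s : seq E.
Hypothesis perm_s : perm_eq s (enum E).

Lemma ordering_uniq : uniq s.
Proof. by rewrite (perm_uniq perm_s) enum_uniq. Qed.

Lemma ordering_mem x : x \in s.
Proof. by rewrite (perm_mem perm_s) mem_enum. Qed.

Lemma in_prefix_set x k : (x \in prefix_set s k) = (index x s <= k)%N.
Proof. by rewrite inE in_take ?ordering_mem. Qed.

Lemma ordering_inh k : (k < size s)%N -> inhabited E.
Proof. by case: (s) => // x0 *. Qed.

Lemma prefix_set_inj k j : (k < size s)%N -> (j < size s)%N ->
  prefix_set s k = prefix_set s j -> k = j.
Proof.
move=> ks js e; have [x0] := ordering_inh ks.
apply/eqP; rewrite eqn_leq; apply/andP; split.
  rewrite -[k in (k <= _)%N](index_uniq x0 ks ordering_uniq) -in_prefix_set -e.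
  by rewrite in_prefix_set index_uniq // ordering_uniq.
rewrite -[j in (j <= _)%N](index_uniq x0 js ordering_uniq) -in_prefix_set e.
by rewrite in_prefix_set index_uniq // ordering_uniq.
Qed.

Lemma prefix_set_neq0 k : (k < size s)%N -> prefix_set s k != set0.
Proof.
move=> ks; have [x0] := ordering_inh ks; apply/set0Pn; exists (nth x0 s k).
by rewrite in_prefix_set index_uniq // ordering_uniq.
Qed.

Lemma gap_neq0 k : (k < size s)%N -> gap s k != 0.
Proof.
move=> ks; have [x0] := ordering_inh ks; have us := ordering_uniq.
rewrite /gap (nth_map x0) //.
rewrite subr_eq0; move: ks; rewrite leq_eqVlt => /predU1P[e|ks].
  by rewrite e [X in _ != X]nth_default ?size_map ?weight_neq0.
rewrite (nth_map x0) // (inj_eq weight_inj) nth_uniq // 1?ltnW //.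
by rewrite neq_ltn ltnSn.
Qed.

(** The prefixes containing [i] are those from the position of [i] on, and their gaps telescope. *)
Lemma xval_linear i : \sum_(F : neset E | i \in val F) xval s (val F) = weight i.
Proof.
rewrite /xval exchange_big /=.
transitivity (\sum_(k < size s) (i \in prefix_set s k)%:R * gap s k).
  apply: eq_bigr => k _; rewrite -big_distrl /=; congr (_ * _).
  have nP0 := prefix_set_neq0 (ltn_ord k).
  case iP: (i \in prefix_set s k); last first.
    rewrite big1 // => F iF; case: eqP => // eF; by rewrite -eF iP in iF.
  rewrite (bigD1 (Sub (prefix_set s k) nP0 : neset E)) //= eqxx big1 ?addr0 // => F /andP[_ nF].
  case: eqP => // eF; case/eqP: nF; exact/val_inj.
have is_ : (index i s < size s)%N by rewrite index_mem ordering_mem.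
rewrite (eq_bigr (fun k : 'I__ => if (index i s <= k)%N then gap s k else 0)); last first.
  by move=> k _; rewrite in_prefix_set; case: leqP; rewrite ?mul1r ?mul0r.
rewrite -(big_mkord xpredT (fun k => if (index i s <= k)%N then gap s k else 0)).
rewrite (big_cat_nat (n := index i s)) ?(ltnW is_) //= big_nat big1 ?add0r; last first.
  by move=> k /andP[_ ki]; rewrite leqNgt ki.
rewrite (eq_big_nat _ _ (F2 := fun k => - ((map weight s)`_k.+1 - (map weight s)`_k))).
  rewrite sumrN telescope_sumr ?(ltnW is_) // opprB [X in _ - X]nth_default ?size_map //.
  by rewrite subr0 (nth_map i) // nth_index ?ordering_mem.
by move=> k /andP[ik _]; rewrite ik opprB.
Qed.

Lemma xval_eq0 F : (forall k, (k < size s)%N -> prefix_set s k != F) -> xval s F = 0.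
Proof.
by move=> nF; rewrite /xval big1 // => k _; rewrite (negPf (nF k _)) ?mul0r.
Qed.

Lemma xval_prefix k : (k < size s)%N -> xval s (prefix_set s k) = gap s k.
Proof.
move=> ks; rewrite /xval (bigD1 (Ordinal ks)) //= eqxx mul1r big1 ?addr0 // => j nj.
case: eqP => [e|]; last by rewrite mul0r.
by case/eqP: nj; apply/val_inj/(prefix_set_inj _ _ e).
Qed.

Lemma xval_neq0P F :
  reflect (exists2 k, (k < size s)%N & prefix_set s k = F) (xval s F != 0).
Proof.
apply: (iffP idP) => [nz|[k ks <-]]; last by rewrite xval_prefix ?gap_neq0.
have [/existsP[k /eqP e]|/existsPn nF] := boolP [exists k : 'I_(size s), prefix_set s k == F].
  by exists k.
by rewrite xval_eq0 ?eqxx // in nz => k ks; apply: (nF (Ordinal ks)).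
Qed.

(** Only prefixes of [s] have a nonzero value, and they form a chain. *)
Lemma xval_mul0 F1 F2 : ~~ (F1 \subset F2) -> ~~ (F2 \subset F1) ->
  xval s F1 * xval s F2 = 0.
Proof.
move=> n12 n21; apply/eqP; rewrite mulf_eq0; apply/norP.
case=> /xval_neq0P[k ks ek] /xval_neq0P[j js ej].
have sub a b : (a <= b)%N -> prefix_set s a \subset prefix_set s b.
  by move=> ab; apply/subsetP => x; rewrite !in_prefix_set => /leq_trans; apply.
by case/orP: (leq_total k j) => /sub; rewrite ek ej ?(negPf n12) ?(negPf n21).
Qed.

End Ordering.

(** Every prefix of [s] is a prefix of [s'], of the same length by cardinality; the position of an
    element is then the same in both, as the index of the first prefix containing it. *)
Lemma ordering_eq s s' : perm_eq s (enum E) -> perm_eq s' (enum E) ->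
  (forall k, (k < size s)%N -> xval s' (prefix_set s k) != 0) -> s = s'.
Proof.
move=> ps ps' nz; have e_size : size s = size s'.
  by rewrite (perm_size ps) (perm_size ps').
have e_pre k : (k < size s)%N -> prefix_set s k = prefix_set s' k.
  move=> ks; have /(xval_neq0P ps')[j js' e] := nz k ks.
  rewrite -e; congr prefix_set; apply/eqP; rewrite -eqSS.
  have cardP r i : perm_eq r (enum E) -> (i < size r)%N -> #|prefix_set r i| = i.+1.
    move=> pr ir; rewrite cardsE; have /card_uniqP -> : uniq (take i.+1 r).
      by rewrite take_uniq // (ordering_uniq pr).
    by rewrite size_takel.
  by rewrite -(cardP s') // e (cardP s).
have e_index x : index x s = index x s'.
  have xs : (index x s < size s)%N by rewrite index_mem (ordering_mem ps).
  have xs' : (index x s' < size s)%N by rewrite e_size index_mem (ordering_mem ps').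
  apply/eqP; rewrite eqn_leq -(in_prefix_set ps) e_pre // (in_prefix_set ps') leqnn /=.
  by rewrite -(in_prefix_set ps') -e_pre // (in_prefix_set ps) leqnn.
case: s ps e_size e_index {nz e_pre} => [|x0 s] ps e_size e_index.
  by symmetry; apply/size0nil; rewrite -e_size.
apply: (@eq_from_nth _ x0) => // k ks.
rewrite -[LHS](nth_index x0 (ordering_mem ps' _)) -e_index index_uniq //.
exact: ordering_uniq ps.
Qed.

End Localization.

(** * Evaluation of polynomials at orderings *)

Section Evaluation.

Local Open Scope ring_scope.

(** The variable of the target polynomials records the degree, so that homogeneous parts can be
    separated after evaluation. *)
Lemma coef_mmapX n (c : 'I_n -> rat) (p : {mpoly rat[n]}) k :
  (mmap (@polyC rat) (fun i => (c i)%:P * 'X) p)`_k =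
  \sum_(m <- msupp p | mdeg m == k) p@_m * mmap1 c m.
Proof.
rewrite /mmap coef_sum [RHS]big_mkcond; apply: eq_bigr => m _.
have -> : mmap1 (fun i => (c i)%:P * 'X) m = (mmap1 c m)%:P * 'X^(mdeg m).
  rewrite /mmap1 mdegE -prodrXr rmorph_prod -big_split /=.
  by apply: eq_bigr => i _; rewrite exprMn rmorphXn.
rewrite mulrA -polyCM coefCM coefXn eq_sym.
by case: eqP; rewrite ?mulr1 ?mulr0.
Qed.

Variable E : finType.
Local Notation QX := {mpoly rat[#|neset E|]}.

Definition xeval (s : seq E) : QX -> {poly rat} :=
  mmap (@polyC rat) (fun i => (xval s (val (enum_val i)))%:P * 'X).

HB.instance Definition _ s := GRing.RMorphism.on (xeval s).

Lemma xeval_pvar s (F : neset E) : xeval s (pvar rat F) = (xval s (val F))%:P * 'X.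
Proof. by rewrite /xeval mmapX mmap1U enum_rankK. Qed.

Lemma xeval_linear s i : perm_eq s (enum E) ->
  xeval s (\sum_(F : neset E | i \in val F) pvar rat F) = (weight i)%:P * 'X.
Proof.
move=> ps; rewrite rmorph_sum -(xval_linear ps) rmorph_sum big_distrl /=.
by apply: eq_bigr => F _; rewrite xeval_pvar.
Qed.

(** At every ordering the quadratic generators vanish and the linear generator of [i] becomes
    [weight i] times the variable. Replacing each linear generator by the constant [weight i] in the
    combination gives one [a] that serves all orderings. *)
Lemma xeval_chow_ideal (p : QX) : chow_ideal p ->
  exists a : QX, forall s, perm_eq s (enum E) -> xeval s p = 'X * xeval s a.
Proof.
case/asboolP => _ [_ [[l lin_l ->] [l' quad_l' ->] ->]].
have quad0 s : perm_eq s (enum E) -> xeval s (\sum_(c <- l') c.1 * c.2) = 0.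
  move=> ps; rewrite rmorph_sum big_seq big1 // => c /quad_l'[F1 [F2 [n12 n21 e]]].
  rewrite e !rmorphM /= !xeval_pvar mulrACA -polyCM (xval_mul0 ps n12 n21).
  by rewrite mul0r mulr0.
suff [a ea] : exists a : QX, forall s, perm_eq s (enum E) ->
    xeval s (\sum_(c <- l) c.1 * c.2) = 'X * xeval s a.
  by exists a => s ps; rewrite rmorphD /= quad0 // addr0 ea.
elim: l lin_l => [_|c l IHl lin_l].
  by exists 0 => s _; rewrite big_nil !rmorph0 mulr0.
have [c' c'l|a ea] := IHl; first by apply: lin_l; rewrite inE c'l orbT.
have [i ec] := lin_l c (mem_head _ _).
exists ((weight i)%:MP * c.1 + a) => s ps.
rewrite big_cons rmorphD rmorphM /= ec xeval_linear // ea // [in RHS]rmorphD rmorphM /=.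
rewrite [xeval s _%:MP]mmapC mulrDr; congr (_ + _).
by rewrite mulrCA [RHS]mulrCA; congr (_ * _); apply: mulrC.
Qed.

End Evaluation.

(** * Normal monomials as functions on orderings *)

Section Functions.

Variables (d : Order.disp_t) (E : finOrderType d).
Local Open Scope ring_scope.
Local Notation mon := 'X_{1..#|bigset E|}.
Local Notation QX := {mpoly rat[#|neset E|]}.
Implicit Types (A : {set {set E}}) (m : mon) (v w : bigset E).

Definition gval (s : seq E) v : rat :=
  \sum_(S : {set E} | S \subset [set i | (setmax (bigset_ne v) < i)%O])
     xval s (val v :|: S).

Definition gmon s m : rat := mmap1 (fun i => gval s (enum_val i)) m.

Lemma gmonD s m1 m2 : gmon s (m1 + m2)%MM = gmon s m1 * gmon s m2.
Proof.
rewrite /gmon /mmap1 -big_split /=; apply: eq_bigr => i _.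
by rewrite mnmDE exprD.
Qed.

Lemma gmon_mvar s v : gmon s (mvar v) = gval s v.
Proof. by rewrite /gmon mmap1U enum_rankK. Qed.

Lemma gmon0 s : gmon s 0%MM = 1.
Proof. exact: mmap11. Qed.

Lemma xeval_lift s (p : {mpoly rat[#|bigset E|]}) :
  xeval s (ss_lift p) =
  mmap (@polyC rat) (fun i => (gval s (enum_val i))%:P * 'X) p.
Proof.
rewrite /ss_lift /mmap rmorph_sum; apply: eq_bigr => m _; rewrite rmorphM /=.
rewrite [xeval s _%:MP]mmapC; congr (_ * _); rewrite /mmap1 rmorph_prod.
apply: eq_bigr => i _; rewrite rmorphXn rmorph_sum /=; congr (_ ^+ _).
rewrite /gval rmorph_sum big_distrl /=.
by apply: eq_bigr => S _; rewrite xeval_pvar.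
Qed.

Lemma coef_xeval_lift s (p : {mpoly rat[#|bigset E|]}) k :
  (xeval s (ss_lift p))`_k = \sum_(m <- msupp p | mdeg m == k) p@_m * gmon s m.
Proof. by rewrite xeval_lift coef_mmapX. Qed.

Lemma sum_msupp_pred1 n (p : {mpoly rat[n]}) (m0 : 'X_{1..n}) (f : 'X_{1..n} -> rat) :
  \sum_(m <- msupp p | m == m0) p@_m * f m = p@_m0 * f m0.
Proof.
rewrite -big_filter; have [m0p|m0p] := boolP (m0 \in msupp p).
  by rewrite filter_pred1_uniq ?msupp_uniq // big_seq1.
rewrite (memN_msupp_eq0 m0p) mul0r big_filter big_seq_cond big1 // => m.
by case/andP => mp /eqP e; rewrite -e mp in m0p.
Qed.

(** In the Chow ring x_F is a linear combination [r] of letters. Lifted to polynomials, this holds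
    up to an element of the ideal, which evaluates to the variable times some [a]; in degree 1 it
    only adds the constant term of [a], the same at all orderings. *)
Lemma xval_gval (F : neset E) : exists (c : rat) (r : {mpoly rat[#|bigset E|]}),
  (forall m, m \in msupp r -> exists v, m = mvar v) /\
  forall s, perm_eq s (enum E) ->
    xval s (val F) = c + \sum_(m <- msupp r) r@_m * gmon s m.
Proof.
have [r letters er] : ss_span (letter_in (fun v => val v \subset [set: E])) (chow_x F).
  have -> : chow_x F = chow_xtrace [set: E] (val F).
    rewrite /chow_xtrace (big_pred1 F) // => G.
    by rewrite setIT -val_eqE.
  by apply: chow_xtrace_span; [move=> x y; rewrite !inE|apply: subsetT|apply: (valP F)].
have {}letters m : m \in msupp r -> exists v, m = mvar v.
  by case/letters => v _ ->; exists v.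
have /chow_pi_eq0/xeval_chow_ideal[a ea] : chow_pi (pvar rat F - ss_lift r) = 0.
  by rewrite rmorphB /= -ss_morphismE er subrr.
exists a@_0%MM, r; split=> // s ps; have /(congr1 (fun q : {poly rat} => q`_1)) := ea s ps.
rewrite rmorphB /= coefB xeval_pvar coefCM coefX eqxx mulr1 coef_xeval_lift coefXM /=.
rewrite coef_mmapX [X in _ = X -> _](eq_bigl (fun u : 'X_{1..#|neset E|} => u == 0%MM)) => [|u]; last first.
  exact: mdeg_eq0.
rewrite sum_msupp_pred1 mmap11 mulr1 => <-.
rewrite [X in _ = _ - X + _](_ : _ = \sum_(m <- msupp r) r@_m * gmon s m).
  by rewrite subrK.
rewrite big_seq_cond [RHS]big_seq; apply: eq_bigl => m.
by case mr: (m \in msupp r) => //=; have [v ->] := letters m mr; rewrite mdeg_mvar.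
Qed.

Local Notation Pt := (seq_sub (permutations (enum E))).
Local Notation vT := {ffun Pt -> rat^o}.

Lemma orderingP (s : Pt) : perm_eq (ssval s) (enum E).
Proof. by rewrite -mem_permutations; apply: ssvalP. Qed.

Definition gvec m : vT := [ffun s => gmon (ssval s) m].

Definition xmon (s : seq E) (u : 'X_{1..#|neset E|}) : rat :=
  mmap1 (fun i => xval s (val (enum_val i))) u.

Definition xvec u : vT := [ffun s => xmon (ssval s) u].

Lemma span_mul (X : seq vT) (U : {vspace vT}) (g : Pt -> rat) :
    {in X, forall x : vT, ([ffun s => g s * x s] : vT) \in U} ->
  forall f : vT, f \in <<X>>%VS -> ([ffun s => g s * f s] : vT) \in U.
Proof.
elim: X => [_ f|x X IHX UX f].
  rewrite span_nil memv0 => /eqP->; rewrite (_ : finfun _ = 0) ?mem0v //.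
  by apply/ffunP => s; rewrite !ffunE mulr0.
rewrite span_cons => /memv_addP[_ /vlineP[c ->] [f' Xf' ->]].
rewrite (_ : finfun _ = c *: ([ffun s => g s * x s] : vT) + ([ffun s => g s * f' s] : vT)).
  apply: memvD; first by apply/memvZ/UX/mem_head.
  by apply: IHX Xf' => y yX; apply: UX; rewrite inE yX orbT.
by apply/ffunP => s; rewrite !ffunE /= mulrDr /GRing.scale /= mulrCA.
Qed.

Definition family_mon A : mon := (\sum_(v : bigset E | val v \in A) mvar v)%MM.

Lemma family_monE A v : family_mon A (enum_rank v) = (val v \in A).
Proof.
rewrite /family_mon mnm_sumE (eq_bigr (fun w => (w == v : nat))) => [|w _]; last exact: mvarE.
case vA: (val v \in A); last first.
  by rewrite big1 // => w wA; case: eqP => // e; rewrite e vA in wA.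
by rewrite (bigD1 v) //= eqxx big1 // => w /andP[_ /negPf->].
Qed.

(** No set is compatible with itself, so a monomial without an incompatible pair is squarefree and
    is the product over its support. *)
Lemma family_mon_or_not_compat m :
  (exists2 A, A \in families [set: E] & m = family_mon A) \/
  (exists v w, ~~ compat_sym (val v) (val w) /\ (mvar v + mvar w <= m)%MM).
Proof.
pose bad v w := ~~ compat_sym (val v) (val w) && (mvar v + mvar w <= m)%MM.
have [/existsP[v /existsP[w /andP[]]]|/existsPn good] := boolP [exists v, exists w, bad v w].
  by right; exists v, w.
have {}good v w : (mvar v + mvar w <= m)%MM -> compat_sym (val v) (val w).
  by move=> le_m; have /existsPn/(_ w) := good v; rewrite /bad le_m andbT negbK.
have irr v : ~~ compat_sym (val v) (val v).
  rewrite /compat_sym orbb; apply/negP => /compatP[p [q [maxp maxq]]].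
  by rewrite (is_max_uniq maxp maxq) ltxx.
have le1 v : (m (enum_rank v) <= 1)%N.
  rewrite leqNgt; apply: contra (irr v) => m2; apply: good; apply/mnm_lepP => i.
  rewrite -[i]enum_valK mnmDE !mvarE; case: eqP => // <-; exact: m2.
left; exists [set T | [exists v : bigset E, (val v == T) && (m (enum_rank v) == 1%N)]].
  apply/familiesP; split=> [T _|T|T T']; first exact: subsetT.
    by rewrite inE => /existsP[v /andP[/eqP<- _]]; apply: bigset_gt1.
  rewrite !inE => /existsP[v /andP[/eqP<- /eqP mv]] /existsP[w /andP[/eqP<- /eqP mw]] neq.
  have {}neq : v != w by apply: contra_neq neq => ->.
  apply: good; apply/mnm_lepP => i; rewrite -[i]enum_valK mnmDE !mvarE.
  have [<-|_] := eqVneq v; first by rewrite mv eq_sym (negPf neq).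
  by have [<-|_] := eqVneq w; rewrite ?mw.
apply/mnmP => i; rewrite -[i]enum_valK family_monE inE; set v := enum_val i.
apply/eqP; case: existsP => [[w /andP[/eqP/val_inj-> //]]|nv].
rewrite -leqn0 -ltnS ltn_neqAle le1 andbT; apply/eqP => mv; case: nv.
by exists v; rewrite eqxx mv.
Qed.

(** * Independence of the functions of normal monomials *)

Section Independence.

Variable vle : rel (bigset E).
Hypotheses (vle_refl : reflexive vle) (vle_anti : antisymmetric vle).
Hypotheses (vle_trans : transitive vle) (vle_total : total vle).
Hypothesis vle_max : forall F1 F2 : bigset E,
  (setmax (bigset_ne F1) < setmax (bigset_ne F2))%O -> vlt vle F1 F2.
Hypothesis vle_sub : forall F1 F2 : bigset E,
  setmax (bigset_ne F1) = setmax (bigset_ne F2) ->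
  val F2 \proper val F1 -> vlt vle F1 F2.

Definition normal_span (P : pred mon) : {vspace vT} :=
  <<[seq gvec (family_mon A) | A <- enum (families [set: E]) & P (family_mon A)]>>%VS.

Lemma normal_spanS (P Q : pred mon) : {subset P <= Q} ->
  (normal_span P <= normal_span Q)%VS.
Proof.
move=> PQ; apply: sub_span => f /mapP[A]; rewrite mem_filter => /andP[PA fA] ->.
by apply: map_f; rewrite mem_filter fA andbT; apply: PQ.
Qed.

Definition span_deg k := normal_span [pred m | mdeg m < k]%N.
Definition span_lt m0 := normal_span [pred m | deglex vle m m0].
Definition span_le m0 := normal_span [pred m | deglex vle m m0 || (m == m0)].

Lemma deglex_mdeg m m0 : deglex vle m m0 -> (mdeg m <= mdeg m0)%N.
Proof. by case/deglexP => // [/ltnW|[->]]. Qed.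

Lemma span_deg_lt m0 : (span_deg (mdeg m0) <= span_lt m0)%VS.
Proof.
by apply: normal_spanS => m; rewrite !inE => lt_m; apply/deglexP => //; left.
Qed.

Lemma span_le_deg m0 : (span_le m0 <= span_deg (mdeg m0).+1)%VS.
Proof.
by apply: normal_spanS => m; rewrite !inE ltnS => /orP[/deglex_mdeg|/eqP->].
Qed.

Lemma span_le_lt m m0 : deglex vle m m0 -> (span_le m <= span_lt m0)%VS.
Proof.
move=> lt_m; apply: normal_spanS => m'; rewrite !inE => /orP[l|/eqP->//].
exact: deglex_trans l lt_m.
Qed.

(* As a function on orderings, the top degree part of an element of the ideal
   is of lower degree, since the linear relations are deformed to constants. *)
Lemma leading_span (p : {mpoly rat[#|bigset E|]}) :
    @ss_ideal d E p -> p != 0 ->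
    (forall u, (mdeg u < mdeg (leading vle p))%N -> xvec u \in span_deg (mdeg u).+1) ->
    (forall m, deglex vle m (leading vle p) -> gvec m \in span_le m) ->
  gvec (leading vle p) \in span_lt (leading vle p).
Proof.
move=> Ip nz_p xW gW; set m0 := leading vle p in xW gW *.
have lead_p : m0 \in msupp p by apply: leading_supp.
have /chow_pi_eq0/xeval_chow_ideal[a ea] : chow_pi (ss_lift p) = 0.
  by rewrite -ss_morphismE.
(* This function is computed in two ways: as the top degree part of [p], and, since [p] evaluates to
   the variable times [a], as the part of [a] of degree one less, or zero if [p] has degree 0. *)
pose w : vT := [ffun s => (xeval (ssval s) (ss_lift p))`_(mdeg m0)].
have w_lt : w \in span_lt m0.
  apply: subvP (span_deg_lt m0) _ _; case e: (mdeg m0) => [|k].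
    rewrite (_ : w = 0) ?mem0v //; apply/ffunP => s.
    by rewrite !ffunE ea ?orderingP // e coefXM.
  have -> : w = \sum_(u <- msupp a | mdeg u == k) a@_u *: xvec u.
    apply/ffunP => s; rewrite sum_ffunE !ffunE ea ?orderingP // e coefXM /= coef_mmapX.
    by apply: eq_bigr => u _; rewrite !ffunE.
  rewrite memv_suml // => u /eqP eu; apply: memvZ.
  by rewrite -eu in e *; apply: xW; rewrite e.
have w_sum : w = \sum_(m <- msupp p | mdeg m == mdeg m0) p@_m *: gvec m.
  apply/ffunP => s; rewrite sum_ffunE !ffunE coef_xeval_lift.
  by apply: eq_bigr => m _; rewrite !ffunE.
have rest_lt : \sum_(m <- msupp p | (mdeg m == mdeg m0) && (m != m0)) p@_m *: gvec m
    \in span_lt m0.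
  rewrite big_seq_cond memv_suml // => m /and3P[mp _ nm]; apply: memvZ.
  have lt_m : deglex vle m m0 by apply: leading_max.
  by apply: subvP (span_le_lt lt_m) _ (gW _ lt_m).
have : p@_m0 *: gvec m0 \in span_lt m0.
  suff -> : p@_m0 *: gvec m0 = w -
     \sum_(m <- msupp p | (mdeg m == mdeg m0) && (m != m0)) p@_m *: gvec m.
    by rewrite memvB.
  by rewrite w_sum big_mkcond (bigD1_seq m0) ?msupp_uniq //= eqxx -big_mkcondl addrK.
rewrite rpredZeq => /orP[/eqP p0|//].
by rewrite mcoeff_msupp p0 eqxx in lead_p.
Qed.

(** The quadratic relation of the pair, multiplied by the complementary monomial, is an element of
    the ideal with leading monomial [m], to which [leading_span] applies. *)
Lemma not_compat_span m v w : ~~ compat_sym (val v) (val w) ->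
    (mvar v + mvar w <= m)%MM ->
    (forall u, (mdeg u < mdeg m)%N -> xvec u \in span_deg (mdeg u).+1) ->
    (forall m', deglex vle m' m -> gvec m' \in span_le m') ->
  gvec m \in span_lt m.
Proof.
move=> nvw le_m; have [q [[Iq _] nz_q lead_q]] :=
  quadratic_relation vle_refl vle_anti vle_trans vle_total vle_max vle_sub nvw.
set m2 := (_ + _)%MM in le_m lead_q; pose r := q * 'X_[m - m2].
have supp_r := msuppMX q (m - m2)%MM; rewrite -/r in supp_r.
have lead_r : leading vle r = m.
  have qm2 : m2 \in msupp q by rewrite -lead_q leading_supp.
  have em : m = (m - m2 + m2)%MM by rewrite submK.
  apply: leadingP => //.
    by rewrite (perm_mem supp_r) {1}em map_f.
  move=> _ /[!(perm_mem supp_r)] /mapP[m' m'q ->] neq.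
  rewrite {2}em ![(_ - _ + _)%MM]addmC; apply: deglex_add => //.
  by rewrite -lead_q leading_max // lead_q; apply: contra_neq neq => ->.
have nz_r : r != 0 by rewrite -msupp_eq0 -size_eq0 (perm_size supp_r) size_map size_eq0 msupp_eq0.
have Ir : @ss_ideal d E r by rewrite /ss_ideal rmorphM /= (Iq : ss_morphism q = 0) mul0r.
by rewrite -lead_r; apply: leading_span.
Qed.

(** The two parts advance together by induction on the degree. For [gvec m], an inner induction
    along [deglex] rewrites an incompatible pair, using [xvec] in lower degrees only. For [xvec u],
    one variable is split off and replaced by a constant plus a combination of letters, and
    multiplying by a letter raises the degree by one. *)
Lemma monomial_spans k :
  (forall m, (mdeg m < k)%N -> gvec m \in span_le m) /\
  (forall u, (mdeg u < k)%N -> xvec u \in span_deg (mdeg u).+1).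
Proof.
elim: k => [//|k [IHg IHx]].
have gW m : (mdeg m < k.+1)%N -> gvec m \in span_le m.
  elim/(well_founded_ind (deglex_wf vle_refl vle_anti vle_trans vle_total)): m => m IHm.
  rewrite ltnS => le_mk.
  case: (family_mon_or_not_compat m) => [[A fA ->]|[v [w [nvw le_m]]]].
    apply: memv_span; apply: map_f; rewrite mem_filter mem_enum fA andbT.
    by rewrite inE eqxx orbT.
  apply: subvP (_ : gvec m \in span_lt m); first last.
    apply: not_compat_span nvw le_m _ _ => [u lt_u|m' lt_m'].
      by apply: IHx; apply: leq_trans lt_u le_mk.
    by apply: IHm => //; rewrite ltnS (leq_trans (deglex_mdeg lt_m')).
  by apply: normal_spanS => m'; rewrite !inE => ->.
split=> // u; rewrite ltnS => le_uk.
have [u0|nu0] := eqVneq (mdeg u) 0%N.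
  have -> : xvec u = gvec 0%MM.
    apply/ffunP => s; rewrite !ffunE gmon0; move/eqP: u0; rewrite mdeg_eq0 => /eqP->.
    exact: mmap11.
  have g0 : gvec 0%MM \in span_le 0%MM by apply: gW; rewrite mdeg0.
  by have := subvP (span_le_deg _) _ g0; rewrite mdeg0 u0.
have [i ui] : exists i, u i != 0%N.
  apply/existsP; apply: contra_neqT nu0 => /existsPn u0; rewrite mdegE big1 // => i _.
  by apply/eqP; have := u0 i; rewrite negbK.
have eu : u = (U_(i) + (u - U_(i)))%MM by rewrite addmC submK // lep1mP.
set u' := (u - U_(i))%MM in eu; have du : mdeg u = (mdeg u').+1 by rewrite eu mdegD mdeg1.
have u'W : xvec u' \in span_deg (mdeg u).
  by rewrite du; apply: IHx; rewrite -ltnS -du.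
have gvW v (f : vT) : f \in span_deg (mdeg u) ->
    ([ffun s => gval (ssval s) v * f s] : vT) \in span_deg (mdeg u).+1.
  apply: span_mul => g /mapP[A]; rewrite mem_filter inE => /andP[lt_A _] ->.
  have -> : ([ffun s => gval (ssval s) v * gvec (family_mon A) s] : vT)
          = gvec (mvar v + family_mon A)%MM.
    by apply/ffunP => s; rewrite !ffunE gmonD gmon_mvar.
  have le_A : (mdeg (mvar v + family_mon A)%MM <= mdeg u)%N by rewrite mdegD mdeg_mvar.
  have := gW (mvar v + family_mon A)%MM; rewrite ltnS => /(_ (leq_trans le_A le_uk)).
  apply: subvP; apply: subv_trans (span_le_deg _) _.
  by apply: normal_spanS => m; rewrite !inE => /leq_trans; apply.
have [c [r [letters er]]] := xval_gval (enum_val i).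
have -> : xvec u = c *: xvec u' +
    \sum_(m <- msupp r) r@_m *: ([ffun s => gmon (ssval s) m * xvec u' s] : vT).
  apply/ffunP => s; rewrite !ffunE sum_ffunE eu.
  rewrite (_ : xmon _ _ = xval (ssval s) (val (enum_val i)) * xmon (ssval s) u'); last first.
    rewrite /xmon /mmap1 -[X in X * _](mmap1U (fun i => xval (ssval s) (val (enum_val i)))).
    rewrite /mmap1 -big_split /=; apply: eq_bigr => j _.
    by rewrite mnmDE exprD.
  rewrite (er _ (orderingP s)) mulrDl; congr (_ + _); rewrite big_distrl /=.
  by apply: eq_bigr => m _; rewrite !ffunE -mulrA.
apply: memvD.
  apply: memvZ; apply: subvP u'W; apply: normal_spanS => m.
  by rewrite !inE => /ltnW; rewrite ltnS.
rewrite big_seq memv_suml // => m mr; apply: memvZ; have [v ->] := letters m mr.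
rewrite (_ : finfun _ = [ffun s => gval (ssval s) v * xvec u' s]); first exact: gvW.
by apply/ffunP => s; rewrite [LHS]ffunE [RHS]ffunE gmon_mvar.
Qed.

(** The product of the x_F over all prefixes F of an ordering is nonzero there and vanishes at every
    other ordering, so each indicator function is a multiple of some [xvec u]. *)
Lemma normal_span_full : normal_span predT = fullv.
Proof.
apply/eqP; rewrite eqEsubv subvf /=; apply/subvP => f _.
have xN u : xvec u \in normal_span predT.
  have [_ xW] := monomial_spans (mdeg u).+1.
  by apply: subvP (xW u (ltnSn _)); apply: normal_spanS.
have -> : f = \sum_(s : Pt) f s *: ([ffun s' => (s' == s)%:R] : vT).
  apply/ffunP => s; rewrite sum_ffunE (bigD1 s) //= !ffunE eqxx.
  rewrite big1 => [|s' ns]; last by rewrite !ffunE eq_sym (negPf ns) scaler0.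
  by rewrite addr0 /GRing.scale /= mulr1.
rewrite memv_suml // => s _; apply: memvZ.
pose u := (\sum_(F : neset E | xval (ssval s) (val F) != 0%R) mvar F)%MM.
have eu s' : xmon s' u = \prod_(F : neset E | xval (ssval s) (val F) != 0) xval s' (val F).
  rewrite /xmon /u; elim/big_rec2: _ => [|F x m _ IH]; first exact: mmap11.
  have -> : xval s' (val F) = mmap1 (fun i => xval s' (val (enum_val i))) (mvar F).
    by rewrite mmap1U enum_rankK.
  rewrite -IH /mmap1 -big_split /=; apply: eq_bigr => j _.
  by rewrite mnmDE exprD.
have nz : xmon (ssval s) u != 0 by rewrite eu; apply/prodf_neq0.
have -> : ([ffun s' => (s' == s)%:R] : vT) = (xmon (ssval s) u)^-1 *: xvec u.
  apply/ffunP => s'; rewrite !ffunE; have [->|ns] := eqVneq s' s.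
    by rewrite /GRing.scale /= mulVf.
  suff -> : xmon (ssval s') u = 0 by rewrite scaler0.
  apply/eqP; apply: contraR ns; rewrite eu => nz'; apply/eqP/val_inj/esym.
  apply: ordering_eq (orderingP s) (orderingP s') _ => k ks.
  pose F : neset E := Sub (prefix_set (ssval s) k) (prefix_set_neq0 (orderingP s) ks).
  by apply: (elimT (prodf_neq0 _ _) nz' F); apply/(xval_neq0P (orderingP s)); exists k.
by apply: memvZ.
Qed.

(** At most n! functions span a space of dimension n!, so they are free; [span_lt] is spanned by
    some of those other than the one of A. *)
Lemma normal_independent A : A \in families [set: E] ->
  gvec (family_mon A) \notin span_lt (family_mon A).
Proof.
move=> fA; pose X := [seq gvec (family_mon B) | B <- enum (families [set: E])].
have spanX : <<X>>%VS = fullv.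
  by rewrite -normal_span_full /normal_span filter_predT.
have freeX : free X.
  rewrite /free eqn_leq dim_span spanX dimvf /X size_map -cardE.
  apply: leq_trans (card_families _) _; rewrite cardsT.
  rewrite [dim _](_ : _ = #|{: Pt}| * 1)%N // muln1 card_seq_sub ?permutations_uniq //.
  by rewrite size_permutations ?enum_uniq // -cardE.
have Aenum : A \in enum (families [set: E]) by rewrite mem_enum.
have := perm_map (fun B => gvec (family_mon B)) (perm_to_rem Aenum).
move/perm_free; rewrite -/X freeX /= free_cons => /esym/andP[nA _].
apply: contra nA; apply: subvP; apply: sub_span => f /mapP[B].
rewrite mem_filter inE => /andP[lt_B fB] ->; apply: map_f.
rewrite mem_rem_uniq ?enum_uniq // inE fB andbT; apply: contraTneq lt_B => ->.
by rewrite deglex_irr.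
Qed.

(** If the leading monomial had only normal pairs, [leading_span] would contradict
    [normal_independent]. *)
Lemma leading_not_normal (p : {mpoly rat[#|bigset E|]}) :
    @ss_ideal d E p -> p != 0 ->
  exists v w, ~~ compat_sym (val v) (val w) /\ (mvar v + mvar w <= leading vle p)%MM.
Proof.
move=> Ip nz_p; case: (family_mon_or_not_compat (leading vle p)) => // -[A fA eA].
have /negP[] := normal_independent fA; rewrite -eA; apply: leading_span => // [u _|m _].
  by have [_] := monomial_spans (mdeg u).+1; apply.
by have [+ _] := monomial_spans (mdeg m).+1; apply.
Qed.

End Independence.

End Functions.

(** * The Gröbner basis and its normal quadratic monomials *)

Lemma mvar2_le (V : finType) (v w s t : V) : (mvar v + mvar w <= mvar s + mvar t)%MM ->
  v = s /\ w = t \/ v = t /\ w = s.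
Proof.
move=> /mnm_lepP le_m; move: (le_m (enum_rank v)) (le_m (enum_rank w)).
rewrite !mnmDE !mvarE !eqxx [w == v]eq_sym.
have [<-|nvw] := eqVneq v w.
  have [->|_] := eqVneq s v; last by case: (t == v).
  by have [->|_] := eqVneq t v; [left|].
have [->|_] := eqVneq s v; first by rewrite (negPf nvw); have [->|] := eqVneq t w; [left|].
have [->|//] := eqVneq t v; rewrite (negPf nvw).
by have [->|//] := eqVneq s w; right.
Qed.

Theorem proposition3p12 (d : Order.disp_t) (E : finOrderType d)
    (vle : rel (bigset E))
    (vle_refl : reflexive vle) (vle_anti : antisymmetric vle)
    (vle_trans : transitive vle) (vle_total : total vle)
    (vle_max : forall F1 F2 : bigset E,
       (setmax (bigset_ne F1) < setmax (bigset_ne F2))%O -> vlt vle F1 F2)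
    (vle_sub : forall F1 F2 : bigset E,
       setmax (bigset_ne F1) = setmax (bigset_ne F2) ->
       val F2 \proper val F1 -> vlt vle F1 F2) :
  [/\ groebner_basis vle (@ss_ideal d E) (@ss_ideal2 d E),
      quadratic (@ss_ideal2 d E)
    & forall S1 S2 : bigset E,
        normal_monomial vle (@ss_ideal2 d E) (mvar S1 + mvar S2)%MM <->
        normal_pair (bigset_ne S1) (bigset_ne S2) \/
        normal_pair (bigset_ne S2) (bigset_ne S1)].
Proof.
have rel v w := @quadratic_relation _ _ _ vle_refl vle_anti vle_trans vle_total
  vle_max vle_sub v w.
have lead p := @leading_not_normal _ _ _ vle_refl vle_anti vle_trans vle_total
  vle_max vle_sub p.
split=> [|q [] //|S1 S2].
  split=> [q []//|p Ip nz_p]; have [v [w [nvw le_p]]] := lead p Ip nz_p.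
  by have [q [Iq nz_q eq]] := rel v w nvw; exists q; rewrite eq.
apply: iff_trans (compat_sym_normal_pair S1 S2); split=> [normal|c12 q [Iq _] nz_q].
  apply/negPn/negP => /rel[q [Iq nz_q eq]].
  by have := normal q Iq nz_q; rewrite eq lepm_refl.
(* A leading monomial dividing that of S1 and S2 contains an incompatible pair, which by degree can
   only be S1 and S2. *)
apply/negP => le_q; have [v [w [nvw le_vw]]] := lead q Iq nz_q.
case: (mvar2_le (lepm_trans le_vw le_q)) => -[ev ew].
  by rewrite ev ew c12 in nvw.
by rewrite ev ew compat_symC c12 in nvw.
Qed.
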